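(* Let $X=\mathbf P^1\setminus\{0,1,\infty\}$. Let $d$ be the canonical de Rham path from $\overrightarrow{01}$ to $\overrightarrow{10}$ and $b$ the Betti path from $\overrightarrow{01}$ to $\overrightarrow{10}$ given by the real interval $(0,1)$, regarded as a de Rham path over $\mathbf C$ via the Hodge comparison isomorphism. Then the de Rham loop $d^{-1}b\in\pi_1^{\mathrm{DR}}(X:\overrightarrow{01})(\mathbf C)$ corresponds under the embedding $i$ to the Drinfel'd associator: $$i(d^{-1}b)=\Phi_{\mathrm{KZ}}\in\mathbf C\langle\langle A,B\rangle\rangle.$$
   Context: **De Rham side.** $X=\mathbf P^1\setminus\{0,1,\infty\}$ with coordinate $t$, $\overline X=\mathbf P^1$, $D=\{0,1,\infty\}$. For a field $K$ of characteristic $0$, $\mathcal{NC}^{\mathrm{DR}}(X_K)$ is the tannakian category of unipotent (iterated extensions of the unit object) bundles with integrable connection on $X_K$. The canonical (log, nilpotent residue) extension to $\overline X$ of such an object has trivial underlying bundle; with $V$ its space of global sections the object is $(V\otimes\mathcal O_X,\,d+\omega)$, $\omega\in H^0(\overline X,\Omega^1(\log D))\otimes \mathrm{End}\,V$. Fiber functors: $\omega_\Gamma$ (value $V$); for $s\in D$ and a $K$-point $t_s$ of $T_s^\times=T_s\overline X\setminus\{0\}$, $\omega_{t_s}$ = fiber at $t_s$ of $(V\otimes\mathcal O_{T_s^\times},\,d+\mathrm{Res}_s(\omega)\frac{dt_s}{t_s})$. $\overrightarrow{01}$ is the point $t_0=1$ of $T_0^\times$ ($t_0$ induced by $t$), $\overrightarrow{10}$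 the point $t_1=1$ of $T_1^\times$ ($t_1$ induced by $1-t$). $\pi_1^{\mathrm{DR}}(X_K:*,*')=\underline{\mathrm{Isom}}^\otimes(\omega_*,\omega_{*'})$; $\gamma'\gamma$ means first $\gamma$, then $\gamma'$. All these functors are canonically isomorphic to $\omega_\Gamma$, giving canonical paths $d_{*,*'}$; $d=d_{\overrightarrow{01},\overrightarrow{10}}$. Let $x\in\pi_1^{\mathrm{DR}}(X:\overrightarrow{01})$ be the image of the exponential of the dual of $\frac{dt_0}{t_0}$ in $\pi_1^{\mathrm{DR}}(T_0^\times:\overrightarrow{01})$, $y'\in\pi_1^{\mathrm{DR}}(X:\overrightarrow{10})$ similarly for $\frac{dt_1}{t_1}$ on $T_1^\times$, $y=d^{-1}y'd$ (on $V$, $x$ acts by $\exp(-\mathrm{Res}_0\omega)$, $y'$ by $\exp(-\mathrm{Res}_1\omega)$). $i:\pi_1^{\mathrm{DR}}(X:\overrightarrow{01})(K)\hookrightarrow K\langle\langle A,B\rangle\rangle$ is the embedding with $x\mapsto e^A$, $y\mapsto e^B$. **Betti side.** $\pi_1^{\mathrm{Be}}(X(\mathbf C):*,*')$ is $\underline{\mathrm{Isom}}^\otimes(\omega_*,\omega_{*'})$ for the category of unipotent local systems of finite dimensional $\mathbf Q$-vector spaces on $X(\mathbf C)$, with fiber functors at (tangential) base points; topological paths give $\mathbf Q$-points. Taking horizontal sections gives the Hodge comparison isomorphism $\pi_1^{\mathrm{DR}}(X:\overrightarrow{01},\overrightarrow{10})\times\mathbf C\cong\pi_1^{\mathrm{Be}}(X(\mathbf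 C):\overrightarrow{01},\overrightarrow{10})\times\mathbf C$; concretely, a horizontal section near $s\in\{0,1\}$, written as $P(t_s)\,t_s^{-\mathrm{Res}_s\omega}v$ with $P$ holomorphic, $P(0)=1$ ($t_0=t$, $t_1=1-t$), corresponds to the vector $v$ in the fiber at the tangential base point $t_s=1$. The path $b$ is the unique element of $\pi_1^{\mathrm{top}}(X(\mathbf R):\overrightarrow{01},\overrightarrow{10})$. **Drinfel'd associator.** Consider $\frac{dG}{dz}=\left(\frac Az+\frac B{z-1}\right)G$ on $0<z<1$; $G_0$ is the solution with $G_0(z)\approx z^A$ as $z\to0$ (i.e. $G_0(z)z^{-A}$ extends holomorphically to $0$ with value $1$), and $\Phi_{\mathrm{KZ}}=\lim_{\epsilon\to0}\exp(-\log\epsilon\cdot B)\,G_0(1-\epsilon)\in\mathbf C\langle\langle A,B\rangle\rangle$ (equivalently $\Phi_{\mathrm{KZ}}=G_1^{-1}G_0$, $G_1$ the solution with $G_1(z)\approx(1-z)^B$ as $z\to1$). *)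

(* Defs.v *)
From HB Require Import structures.
From mathcomp Require Import all_boot all_order all_algebra.
From mathcomp Require Import complex mxtens.
From mathcomp Require Import all_classical all_reals all_analysis.
Set Implicit Arguments.
Unset Strict Implicit.
Unset Printing Implicit Defensive.
Import Order.TTheory GRing.Theory Num.Theory numFieldNormedType.Exports.
Local Open Scope classical_set_scope.
Local Open Scope ring_scope.

Section Connections.
Variable K : fieldType.

Variant cusp := cusp0 | cusp1 | cuspoo.

(* A log connection (V (x) O, d + omega) on P^1 with poles in {0, 1, oo}:
   V = K^rk is the space of column vectors and
   omega = res0 dt/t + res1 dt/(t-1), these two forms being a basis of
   H^0(P^1, Omega^1(log D)).  The residues of omega sum to zero, whence the
   value at cuspoo below; integrability is automatic on a curve. *)
Record conn := Conn { rk : nat; res0 : 'M[K]_rk; res1 : 'M[K]_rk }.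

Definition residue (M : conn) (s : cusp) : 'M[K]_(rk M) :=
  match s with
  | cusp0 => res0 M
  | cusp1 => res1 M
  | cuspoo => - (res0 M + res1 M)
  end.

(* A horizontal O_X-linear map extends to the canonical extensions, hence acts
   on global sections by a constant matrix f with f omega_M = omega_N f. *)
Definition horizontal (M N : conn) (f : 'M[K]_(rk N, rk M)) : Prop :=
  forall s, f *m residue M s = residue N s *m f.

Definition unit_conn : conn := @Conn 1 0 0.

Definition tens_conn (M N : conn) : conn :=
  @Conn (rk M * rk N) (res0 M *t 1%:M + 1%:M *t res0 N)
                      (res1 M *t 1%:M + 1%:M *t res1 N).

(* Iterated extensions 0 -> M' -> M -> 1 -> 0 of the unit object. *)
Inductive unipotent : conn -> Prop :=
| unipotent_zero M : rk M = 0%N -> unipotent M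
| unipotent_extension M' M (j : 'M[K]_(rk M, rk M')) (p : 'M[K]_(1, rk M)) :
    unipotent M' ->
    horizontal j -> @horizontal M unit_conn p ->
    row_full j -> row_free p -> (j^T == kermx p^T)%MS ->
    unipotent M.

(* Words in A, B are sequences of booleans: A is false, B is true. *)
Definition letter_cusp (a : bool) : cusp := if a then cusp1 else cusp0.

(* The action of a word on V, with A, B acting by -Res_0, -Res_1. *)
Definition wordmx (M : conn) (w : seq bool) : 'M[K]_(rk M) :=
  foldr (fun a X => - residue M (letter_cusp a) *m X) 1%:M w.

Lemma wordmx_cat M u v : wordmx M (u ++ v) = wordmx M u *m wordmx M v.
Proof. by elim: u => [|a u IH] /=; rewrite ?mul1mx // IH mulmxA. Qed.

Lemma horizontalP (M N : conn) (f : 'M[K]_(rk N, rk M)) :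
  f *m res0 M = res0 N *m f -> f *m res1 M = res1 N *m f -> horizontal f.
Proof.
move=> h0 h1 [] //=.
by rewrite mulmxN mulNmx mulmxDr mulmxDl h0 h1.
Qed.

Lemma horizontal_wordmx (M N : conn) (f : 'M[K]_(rk N, rk M)) :
  horizontal f -> forall w, f *m wordmx M w = wordmx N w *m f.
Proof.
move=> hf; elim=> [|a w IH] /=; first by rewrite mulmx1 mul1mx.
by rewrite mulmxA mulmxN hf -mulNmx -!mulmxA IH.
Qed.

Lemma unipotent_wordmx0 M : unipotent M ->
  forall w, (rk M <= size w)%N -> wordmx M w = 0.
Proof.
elim=> {M} [M M0 w _|M' M j p _ IH hj hp fj fp /eqmxP jp w].
  by apply/matrixP => -[i Hi]; exfalso; rewrite M0 in Hi.
have rkM : rk M = (rk M').+1.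
  have := mxrank_ker p^T; rewrite -jp !mxrank_tr (eqP fj) (eqP fp) => ->.
  have : (\rank p <= rk M)%N by exact: rank_leq_col.
  by rewrite (eqP fp) subn1; case: (rk M).
case/lastP: w => [|w a]; first by rewrite {1}rkM.
rewrite {1}rkM size_rcons ltnS => /IH w0.
have /submxP[X HX] : ((residue M (letter_cusp a))^T <= j^T)%MS.
  rewrite jp; apply/sub_kermxP; rewrite -trmx_mul.
  by rewrite hp; case: a => /=; rewrite mul0mx trmx0.
have {}HX : residue M (letter_cusp a) = j *m X^T.
  by rewrite -[LHS]trmxK HX trmx_mul trmxK.
rewrite -cats1 wordmx_cat /= mulmx1 HX mulmxN mulmxA.
by rewrite -(horizontal_wordmx hj) w0 mulmx0 mul0mx oppr0.
Qed.

Lemma wordmx0_unipotent M n :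
  (forall w, (n <= size w)%N -> wordmx M w = 0) -> unipotent M.
Proof.
move: {2}(rk M) (leqnn (rk M)) => m; elim: m M => [|m IH] M Mm M0.
  by apply: unipotent_zero; apply/eqP; rewrite -leqn0.
have [/eqP rM|rM] := boolP (rk M == 0%N); first exact: unipotent_zero.
have [q q0 [qA qB]] : exists2 q : 'rV[K]_(rk M), q != 0 &
    q *m res0 M = 0 /\ q *m res1 M = 0.
  have [|] := boolP (row_free (row_mx (res0 M) (res1 M))); last first.
    rewrite -kermx_eq0 => /rowV0Pn[q /sub_kermxP]; rewrite mul_mx_row => h q0.
    by exists q => //; move/eqP: h; rewrite row_mx_eq0 => /andP[/eqP-> /eqP->].
  move=> /row_freeP[X]; rewrite -[X]vsubmxK mul_row_col => HX.
  suff h k w : (n - k <= size w)%N -> wordmx M w = 0.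
    have := h n [::]; rewrite subnn => /(_ isT) /= /matrixP.
    have i : 'I_(rk M) by case: (rk M) rM => // k _; exact: ord0.
    by move=> /(_ i i); rewrite !mxE eqxx => /eqP; rewrite oner_eq0.
  elim: k w => [|k IHk] w hw; first by apply: M0; rewrite -(subn0 n).
  have hr a : wordmx M w *m residue M (letter_cusp a) = 0.
    have : wordmx M (rcons w a) = 0.
      by apply: IHk; rewrite size_rcons; move: hw; rewrite subnS; case: (n - k)%N.
    rewrite -cats1 wordmx_cat /= mulmx1 mulmxN => /eqP.
    by rewrite oppr_eq0 => /eqP.
  have := hr true; have := hr false => /= hA hB.
  by rewrite -[LHS]mulmx1 -HX mulmxDr !mulmxA hA hB !mul0mx addr0.
have rq : \rank q = 1%N.
  by apply/eqP; rewrite eqn_leq rank_leq_row lt0n mxrank_eq0.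
pose J := row_base (kermx q^T).
have hJ : (J :=: kermx q^T)%MS by exact: eq_row_base.
pose N s : 'M[K]_(_) := ((residue M s *m J^T)^T *m pinvmx J)^T.
have hN s : J^T *m N s = residue M s *m J^T.
  apply: trmx_inj; rewrite trmx_mul trmxK trmxK mulmxKpV // hJ.
  apply/sub_kermxP; rewrite -trmx_mul mulmxA.
  by case: s => /=; rewrite ?mulmxN ?mulmxDr ?qA ?qB ?addr0 ?oppr0 mul0mx trmx0.
pose M' := @Conn _ (N cusp0) (N cusp1).
have hj : @horizontal M' M J^T by apply: horizontalP; exact: hN.
have Jfull : row_full J^T by rewrite /row_full mxrank_tr; exact: row_base_free.
apply: (@unipotent_extension M' M J^T q) => //.
- apply: IH => [|w hw].
    rewrite /= mxrank_ker mxrank_tr rq subn1.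
    by move: Mm; case: (rk M).
  have /row_fullP[B HB] := Jfull.
  rewrite -[LHS]mul1mx -HB -mulmxA.
  by rewrite (horizontal_wordmx hj) M0 // mul0mx mulmx0.
- by apply: horizontalP; rewrite /= ?qA ?qB mul0mx.
- by rewrite /row_free rq.
- by rewrite trmxK; apply/eqmxP.
Qed.

Lemma unipotent_unit : unipotent unit_conn.
Proof.
apply: (@wordmx0_unipotent _ 1) => -[|[] w] //= _;
  by rewrite oppr0 mul0mx.
Qed.

Lemma tensmxDl m n p q (A B : 'M[K]_(m, n)) (C : 'M[K]_(p, q)) :
  (A + B) *t C = A *t C + B *t C.
Proof. by apply/matrixP => i j; rewrite !mxE mulrDl. Qed.

Lemma tensmxDr m n p q (C : 'M[K]_(m, n)) (A B : 'M[K]_(p, q)) :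
  C *t (A + B) = C *t A + C *t B.
Proof. by apply/matrixP => i j; rewrite !mxE mulrDr. Qed.

Lemma tensmxNl m n p q (A : 'M[K]_(m, n)) (C : 'M[K]_(p, q)) :
  (- A) *t C = - (A *t C).
Proof. by apply/matrixP => i j; rewrite !mxE mulNr. Qed.

Lemma tensmxNr m n p q (C : 'M[K]_(m, n)) (A : 'M[K]_(p, q)) :
  C *t (- A) = - (C *t A).
Proof. by apply/matrixP => i j; rewrite !mxE mulrN. Qed.

Lemma tensmxZl c m n p q (A : 'M[K]_(m, n)) (C : 'M[K]_(p, q)) :
  (c *: A) *t C = c *: (A *t C).
Proof. by apply/matrixP => i j; rewrite !mxE mulrA. Qed.

Lemma tensmxZr c m n p q (C : 'M[K]_(m, n)) (A : 'M[K]_(p, q)) :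
  C *t (c *: A) = c *: (C *t A).
Proof. by apply/matrixP => i j; rewrite !mxE mulrCA. Qed.

Lemma tens1mx1 m n : (1%:M : 'M[K]_m) *t (1%:M : 'M[K]_n) = 1%:M.
Proof.
apply/matrixP => i j.
case: (mxtens_indexP i) => i0 i1; case: (mxtens_indexP j) => j0 j1.
rewrite tensmxE !mxE -natrM mulnb (can_eq (@mxtens_indexK _ _)).
by rewrite xpair_eqE.
Qed.

Lemma residue_tens M N s :
  residue (tens_conn M N) s = residue M s *t 1%:M + 1%:M *t residue N s.
Proof.
case: s => //=.
by rewrite tensmxNl tensmxNr tensmxDl tensmxDr -opprD addrACA.
Qed.

Lemma unipotent_tens M N :
  unipotent M -> unipotent N -> unipotent (tens_conn M N).
Proof.
move=> /unipotent_wordmx0 hM /unipotent_wordmx0 hN.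
apply: (@wordmx0_unipotent _ (rk M + rk N)) => w hw.
suff h u v : (rk M + rk N <= size u + size v + size w)%N ->
    (wordmx M u *t wordmx N v) *m wordmx (tens_conn M N) w = 0.
  by have := h [::] [::]; rewrite /= tens1mx1 mul1mx; apply.
elim: w {hw} u v => [|a w IH] u v /=.
  rewrite addn0 => h.
  have [hu|hu] := leqP (rk M) (size u); first by rewrite hM // tens0mx mul0mx.
  rewrite [wordmx N v]hN ?tensmx0 ?mul0mx //.
  by rewrite leqNgt; apply/negP => hv; move: h; rewrite leqNgt -addSn leq_add // ltnW.
move=> h; rewrite residue_tens mulmxA opprD -tensmxNl -tensmxNr mulmxDr.
rewrite !tensmx_mul !mulmx1 mulmxDl.
have e X b : wordmx X b *m - residue X (letter_cusp a) = wordmx X (rcons b a).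
  by rewrite -cats1 wordmx_cat /= mulmx1.
by rewrite !e !IH ?addr0 // size_rcons ?addSn ?addnS ?addSn -addnS.
Qed.

(* NC^DR(X_K), each object being given by its canonical extension. *)
Record ncDR := NCDR { conn_of :> conn; ncDR_unipotent : unipotent conn_of }.

Definition ncDR_unit : ncDR := NCDR unipotent_unit.

Definition ncDR_tens (M N : ncDR) : ncDR :=
  NCDR (unipotent_tens (ncDR_unipotent M) (ncDR_unipotent N)).

(* Base points: Gamma (global sections) or a K-point u of T_s^x.  The fibre of
   V (x) O at u is V itself, so all these fibre functors take M to K^(rk M)
   and f to f; the canonical isomorphisms between them are identities. *)
Variant basepoint := Gamma | Tangential (s : cusp) (u : K) of u != 0.

Definition t01 : basepoint := Tangential cusp0 (oner_neq0 K).
Definition t10 : basepoint := Tangential cusp1 (oner_neq0 K).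

End Connections.

Section Paths.
Variables (K L : fieldType) (iota : {rmorphism K -> L}).
Local Notation "A ^i" := (map_mx iota A) (at level 2, format "A ^i").

(* L-points of Isom^(x)(omega_p, omega_q): tensor isomorphisms between the two
   fibre functors extended to L. *)
Record dR_path (p q : basepoint K) := DRPath {
  path_mx :> forall M : ncDR K, 'M[L]_(rk M);
  path_unitmx : forall M, path_mx M \in unitmx;
  path_natural : forall (M N : ncDR K) (f : 'M[K]_(rk N, rk M)),
    horizontal f -> f^i *m path_mx M = path_mx N *m f^i;
  path_tensor : forall M N : ncDR K,
    path_mx (ncDR_tens M N) = path_mx M *t path_mx N;
  path_unit : path_mx (ncDR_unit K) = 1%:M
}.

Lemma dR_path_eq p q (g h : dR_path p q) : (forall M, g M = h M) -> g = h.
Proof.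
case: g h => g g1 g2 g3 g4 [h h1 h2 h3 h4] /= gh.
have {}gh : g = h by apply: functional_extensionality_dep.
rewrite -gh in h1 h2 h3 h4 *.
by congr DRPath; exact: Prop_irrelevance.
Qed.

Section Groupoid.
Variables p q r : basepoint K.

(* The canonical path d_{p,q}. *)
Definition path_can : dR_path p q.
Proof.
exists (fun M => 1%:M).
- by move=> M; exact: unitmx1.
- by move=> M N f _; rewrite mulmx1 mul1mx.
- by move=> M N; rewrite tens1mx1.
- by [].
Defined.

(* First g, then h. *)
Definition path_comp (h : dR_path q r) (g : dR_path p q) : dR_path p r.
Proof.
exists (fun M => h M *m g M).
- by move=> M; rewrite unitmx_mul !path_unitmx.
- by move=> M N f hf; rewrite mulmxA path_natural // -!mulmxA path_natural.
- by move=> M N; rewrite !path_tensor tensmx_mul.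
- by rewrite !path_unit mulmx1.
Defined.

Definition path_inv (g : dR_path p q) : dR_path q p.
Proof.
exists (fun M => invmx (g M)).
- by move=> M; rewrite unitmx_inv path_unitmx.
- move=> M N f hf; apply: (canRL (mulKmx (path_unitmx g N))).
  by rewrite mulmxA -path_natural // mulmxK // path_unitmx.
- move=> M N; rewrite path_tensor.
  have [gM gN] := (path_unitmx g M, path_unitmx g N).
  have e : (g M *t g N) *m (invmx (g M) *t invmx (g N)) = 1%:M.
    by rewrite tensmx_mul !mulmxV // tens1mx1.
  by rewrite -[LHS]mulmx1 -e mulKmx // -path_tensor path_unitmx.
- by rewrite path_unit invmx1.
Defined.

End Groupoid.

Lemma map_tensmx m n p q (A : 'M[K]_(m, n)) (B : 'M[K]_(p, q)) :
  (A *t B)^i = A^i *t B^i.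
Proof. exact: map_mxT. Qed.

End Paths.

Section NilpotentExponential.
Variable L : numFieldType.

(* The exponential of a nilpotent matrix. *)
Definition expmx n (N : 'M[L]_n) : 'M[L]_n :=
  \sum_(k < n) (k`!%:R)^-1 *: (N ^+ k).

Lemma expmx_trunc n (N : 'M[L]_n) m : N ^+ n = 0 -> N ^+ m = 0 ->
  expmx N = \sum_(0 <= k < m) (k`!%:R)^-1 *: (N ^+ k).
Proof.
move=> Nn Nm.
have N0 l k : N ^+ l = 0 -> (l <= k)%N -> (k`!%:R)^-1 *: (N ^+ k) = 0 :> 'M[L]_n.
  by move=> h lk; rewrite -(subnKC lk) exprD h mul0r scaler0.
have aux l k : N ^+ l = 0 -> (l <= k)%N ->
    \sum_(0 <= i < l) (i`!%:R)^-1 *: (N ^+ i)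
      = \sum_(0 <= i < k) (i`!%:R)^-1 *: (N ^+ i) :> 'M[L]_n.
  move=> h lk; rewrite [RHS](@big_cat_nat _ _ _ l 0 k) //=.
  rewrite [X in _ = _ + X]big_nat_cond [X in _ = _ + X]big1 ?addr0 //.
  by move=> i /andP[/andP[li _] _]; exact: N0 h li.
rewrite /expmx -(big_mkord xpredT (fun i => (i`!%:R)^-1 *: (N ^+ i))).
by case: (leqP n m) => h; [exact: aux | rewrite [RHS](aux m n) // ltnW].
Qed.

Lemma expmxD n (X Y : 'M[L]_n) : GRing.comm X Y ->
  X ^+ n = 0 -> Y ^+ n = 0 -> (X + Y) ^+ n = 0 ->
  expmx (X + Y) = expmx X *m expmx Y.
Proof.
move=> cXY Xn Yn XYn.
have XYpow k : (k`!%:R)^-1 *: (X + Y) ^+ k =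
    \sum_(0 <= i < k.+1)
       ((i`!%:R)^-1 *: X ^+ i) *m (((k - i)`!%:R)^-1 *: Y ^+ (k - i)).
  rewrite addrC exprDn_comm; last exact: commr_sym.
  rewrite scaler_sumr big_mkord; apply: eq_bigr => -[i ik] _ /=.
  have sn (M : 'M[L]_n) c : M *+ c = (c%:R : L) *: M by rewrite scaler_nat.
  rewrite -scalemxAl -scalemxAr scalerA sn scalerA.
  congr (_ *: _).
    have kf : (k`!%:R : L) != 0 by rewrite pnatr_eq0 -lt0n fact_gt0.
    apply: (mulfI kf); rewrite mulrA mulfV // mul1r.
    rewrite -(bin_fact (m := i) (n := k)) // natrM natrM.
    by rewrite -invfM mulfK // -natrM pnatr_eq0 -lt0n muln_gt0 !fact_gt0.
  by apply: commrX; apply: commr_sym; apply: commrX; exact: commr_sym.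
have XY0 : (X + Y) ^+ (n + n) = 0.
  rewrite addrC exprDn_comm; last exact: commr_sym.
  rewrite big1 // => -[i ik] _ /=.
  have [ni|ni] := leqP n i.
    by rewrite -(subnKC ni) exprD Xn mul0r mulr0 mul0rn.
  have h : (n <= n + n - i)%N by rewrite -addnBA ?leq_addr // ltnW.
  by rewrite -(subnKC h) exprD Yn !mul0r mul0rn.
rewrite (expmx_trunc XYn XY0).
pose EX i : 'M[L]_n := (i`!%:R)^-1 *: X ^+ i.
pose EY i : 'M[L]_n := (i`!%:R)^-1 *: Y ^+ i.
transitivity (\sum_(0 <= k < n + n)
    \sum_(0 <= i < n + n | (i < k.+1)%N) EX i *m EY (k - i)%N).
  apply: eq_big_nat => k /andP[_ kn]; rewrite XYpow.
  by rewrite (big_nat_widen 0 k.+1 (n + n)).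
rewrite (exchange_big_dep_nat xpredT) //=.
transitivity (\sum_(0 <= i < n + n) EX i *m expmx Y).
  apply: eq_big_nat => i /andP[_ i2n].
  have [ni|ni] := leqP n i.
    have EX0 : EX i = 0 by rewrite /EX -(subnKC ni) exprD Xn mul0r scaler0.
    by rewrite EX0 mul0mx big1 // => k _; rewrite mul0mx.
  rewrite -mulmx_sumr; congr (_ *m _).
  rewrite -(big_nat_widenl i 0 (n + n) xpredT (fun k => EY (k - i)%N)) //.
  rewrite -{1}(add0n i) big_addn.
  have h : (n <= n + n - i)%N by rewrite -addnBA ?leq_addr // ltnW.
  rewrite (@expmx_trunc _ Y (n + n - i)%N) //.
    by apply: eq_bigr => k _; rewrite addnK.
  by rewrite -(subnKC h) exprD Yn mul0r.
rewrite -mulmx_suml (@expmx_trunc _ X (n + n)%N) //.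
by rewrite exprD Xn mul0r.
Qed.

End NilpotentExponential.

Section LocalMonodromy.
Variables (K : fieldType) (L : numFieldType) (iota : {rmorphism K -> L}).
Local Notation "A ^i" := (map_mx iota A) (at level 2, format "A ^i").

Lemma expr_wordmx (M : conn K) a k :
  (- residue M (letter_cusp a)) ^+ k = wordmx M (nseq k a).
Proof. by elim: k => [|k IH] //=; rewrite exprS IH. Qed.

Lemma residue_nilpotent (M : ncDR K) a :
  (- (residue M (letter_cusp a))^i) ^+ rk M = 0.
Proof.
rewrite -map_mxN; transitivity ((wordmx M (nseq (rk M) a))^i).
  by rewrite -expr_wordmx -[RHS]/(map_mx iota _) rmorphXn.
by rewrite unipotent_wordmx0 ?size_nseq ?map_mx0 //; exact: ncDR_unipotent.
Qed.

Lemma expmx0 n : expmx (0 : 'M[L]_n) = 1%:M.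
Proof.
case: n => [|n]; first by apply/matrixP => -[].
rewrite /expmx big_ord_recl fact0 invr1 scale1r expr0 big1 ?addr0 // => k _.
by rewrite exprS mul0r scaler0.
Qed.

Lemma expmx_natural m n (X : 'M[L]_m) (Y : 'M[L]_n) (f : 'M[L]_(n, m)) :
  X ^+ m = 0 -> Y ^+ n = 0 -> f *m X = Y *m f ->
  f *m expmx X = expmx Y *m f.
Proof.
move=> Xm Yn fX.
have fXk k : f *m (X ^+ k) = (Y ^+ k) *m f.
  elim: k => [|k IH]; first by rewrite !expr0 mulmx1 mul1mx.
  rewrite !exprS -[X * _]/(X *m _) -[Y * _]/(Y *m _).
  by rewrite mulmxA fX -mulmxA IH mulmxA.
have Xmn : X ^+ (m + n) = 0 by rewrite exprD Xm mul0r.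
have Ymn : Y ^+ (m + n) = 0 by rewrite exprD Yn mulr0.
rewrite (expmx_trunc Xm Xmn) (expmx_trunc Yn Ymn) mulmx_sumr mulmx_suml.
by apply: eq_bigr => k _; rewrite -scalemxAr -scalemxAl fXk.
Qed.

Lemma mxpow0W n (X : 'M[L]_n) k l : X ^+ k = 0 -> (k <= l)%N -> X ^+ l = 0.
Proof. by move=> Xk kl; rewrite -(subnKC kl) exprD Xk mul0r. Qed.

Lemma expmx_tens1 m n (X : 'M[L]_m) : X ^+ m = 0 ->
  expmx (X *t (1%:M : 'M[L]_n)) = expmx X *t 1%:M.
Proof.
move=> Xm.
have Xk k : (X *t (1%:M : 'M[L]_n)) ^+ k = X ^+ k *t 1%:M.
  elim: k => [|k IH]; first by rewrite !expr0 tens1mx1.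
  by rewrite !exprS IH -[LHS]/(_ *m _) tensmx_mul mulmx1.
case: n Xk => [|n] Xk.
  by apply/matrixP => -[i Hi]; exfalso; rewrite muln0 in Hi.
rewrite (@expmx_trunc _ _ _ m); last 2 first.
- by rewrite Xk (mxpow0W Xm) ?leq_pmulr // tens0mx.
- by rewrite Xk Xm tens0mx.
rewrite /expmx big_mkord.
rewrite (big_morph (fun A : 'M[L]_m => A *t (1%:M : 'M[L]_n.+1)) (id1 := 0) (op1 := +%R)).
- by apply: eq_bigr => k _; rewrite Xk -tensmxZl.
- by move=> A B; exact: tensmxDl.
- exact: tens0mx.
Qed.

Lemma expmx_1tens m n (X : 'M[L]_n) : X ^+ n = 0 ->
  expmx ((1%:M : 'M[L]_m) *t X) = 1%:M *t expmx X.
Proof.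
move=> Xm.
have Xk k : ((1%:M : 'M[L]_m) *t X) ^+ k = 1%:M *t X ^+ k.
  elim: k => [|k IH]; first by rewrite !expr0 tens1mx1.
  by rewrite !exprS IH -[LHS]/(_ *m _) tensmx_mul mulmx1.
case: m Xk => [|m] Xk.
  by apply/matrixP => -[i Hi]; exfalso; rewrite mul0n in Hi.
rewrite (@expmx_trunc _ _ _ n); last 2 first.
- by rewrite Xk (mxpow0W Xm) ?leq_pmull // tensmx0.
- by rewrite Xk Xm tensmx0.
rewrite /expmx big_mkord.
rewrite (big_morph (fun A : 'M[L]_n => (1%:M : 'M[L]_m.+1) *t A) (id1 := 0) (op1 := +%R)).
- by apply: eq_bigr => k _; rewrite Xk -tensmxZr.
- by move=> A B; exact: tensmxDr.
- exact: tensmx0.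
Qed.

Lemma expmx_tens m n (X : 'M[L]_m) (Y : 'M[L]_n) :
  X ^+ m = 0 -> Y ^+ n = 0 -> (X *t 1%:M + 1%:M *t Y) ^+ (m * n) = 0 ->
  expmx (X *t 1%:M + 1%:M *t Y) = expmx X *t expmx Y.
Proof.
move=> Xm Yn XYmn.
have Xk k : (X *t (1%:M : 'M[L]_n)) ^+ k = X ^+ k *t 1%:M.
  elim: k => [|k IH]; first by rewrite !expr0 tens1mx1.
  by rewrite !exprS IH -[LHS]/(_ *m _) tensmx_mul mulmx1.
have Yk k : ((1%:M : 'M[L]_m) *t Y) ^+ k = 1%:M *t Y ^+ k.
  elim: k => [|k IH]; first by rewrite !expr0 tens1mx1.
  by rewrite !exprS IH -[LHS]/(_ *m _) tensmx_mul mulmx1.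
case: m X Xm XYmn Xk Yk => [|m] X Xm XYmn Xk Yk.
  by apply/matrixP => -[i Hi]; exfalso; rewrite mul0n in Hi.
case: n Y Yn XYmn Xk Yk => [|n] Y Yn XYmn Xk Yk.
  by apply/matrixP => -[i Hi]; exfalso; rewrite muln0 in Hi.
rewrite expmxD //.
- by rewrite expmx_tens1 // expmx_1tens // tensmx_mul mulmx1 mul1mx.
- by rewrite /GRing.comm -[LHS]/(_ *m _) -[RHS]/(_ *m _) !tensmx_mul
    !mulmx1 !mul1mx.
- by rewrite Xk (mxpow0W Xm) ?leq_pmulr // tens0mx.
- by rewrite Yk (mxpow0W Yn) ?leq_pmull // tensmx0.
Qed.

(* Local monodromy: exp(-Res_0 omega) or exp(-Res_1 omega) on V. *)
Definition exp_residue (p : basepoint K) (a : bool) : dR_path iota p p.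
Proof.
exists (fun M => expmx (- (residue M (letter_cusp a))^i)).
- move=> M; set X := - _.
  have X0 : X ^+ rk M = 0 by exact: residue_nilpotent.
  have X0' : (- X) ^+ rk M = 0 by rewrite exprNn X0 mulr0.
  suff : expmx X *m expmx (- X) = 1%:M by move/mulmx1_unit => [].
  rewrite -expmxD ?subrr ?expmx0 //; first exact: commrN.
  by case: (rk M) X X0 X0' => [|n] X _ _; [apply/matrixP=> -[] | rewrite expr0n].
- move=> M N f hf; apply: expmx_natural; try exact: residue_nilpotent.
  by rewrite mulmxN mulNmx -!map_mxM hf.
- move=> M N; have := residue_nilpotent (ncDR_tens M N) a.
  rewrite /= residue_tens map_mxD !map_tensmx !map_mx1.
  rewrite opprD -tensmxNl -tensmxNr => h.
  by apply: expmx_tens => //; exact: residue_nilpotent.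
- by case: a => /=; rewrite map_mx0 oppr0 expmx0.
Defined.

Definition path_x : dR_path iota (t01 K) (t01 K) := exp_residue (t01 K) false.
Definition path_y' : dR_path iota (t10 K) (t10 K) := exp_residue (t10 K) true.
Definition path_d : dR_path iota (t01 K) (t10 K) := path_can iota (t01 K) (t10 K).
Definition path_y : dR_path iota (t01 K) (t01 K) :=
  path_comp (path_inv path_d) (path_comp path_y' path_d).

End LocalMonodromy.

Section Series.
Variable L : fieldType.

(* Formal series in A, B, as functions from words to coefficients. *)
Definition ncseries := seq bool -> L.

Definition nc1 : ncseries := fun w => (w == [::])%:R.
Definition ncvar (a : bool) : ncseries := fun w => (w == [:: a])%:R.
Definition ncA := ncvar false.
Definition ncB := ncvar true.
Definition ncadd (S T : ncseries) : ncseries := fun w => S w + T w.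
Definition ncscale (c : L) (S : ncseries) : ncseries := fun w => c * S w.
Definition ncmul (S T : ncseries) : ncseries := fun w =>
  \sum_(i < (size w).+1) S (take i w) * T (drop i w).
Definition ncpow (S : ncseries) (k : nat) : ncseries := iter k (ncmul S) nc1.
(* Meaningful for S without constant term, so that S^k vanishes at words
   shorter than k. *)
Definition ncexp (S : ncseries) : ncseries := fun w =>
  \sum_(k < (size w).+1) (k`!%:R)^-1 * ncpow S k w.

Lemma ncmul_var a S w :
  ncmul (ncvar a) S w = if w is b :: w' then (b == a)%:R * S w' else 0.
Proof.
case: w => [|b w]; first by rewrite /ncmul big_ord_recl big_ord0 /ncvar mul0r addr0.
rewrite /ncmul /= big_ord_recl /ncvar mul0r add0r big_ord_recl /= take0 drop0.
rewrite big1 ?addr0; first by rewrite eqseq_cons eqxx andbT.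
by move=> i _; case: w i => [[]//|c w i]; rewrite /= eqseq_cons andbF mul0r.
Qed.

Lemma ncpow_var a k w : ncpow (ncvar a) k w = (w == nseq k a)%:R.
Proof.
elim: k w => [|k IH] w //; rewrite /ncpow iterS ncmul_var -/(ncpow _ k).
by case: w => [|b w] //; rewrite IH eqseq_cons -natrM mulnb.
Qed.

End Series.

Section UniversalObject.
Variables (K : fieldType) (n : nat).

(* The object K<<A,B>> / (words of length > n), with A = -Res_0 and
   B = -Res_1 acting by left multiplication. *)
Definition word_of (i : 'I_#|{: n.-bseq bool}|) : seq bool :=
  bseqval (enum_val i).

Definition word_conn : conn K :=
  let N a : 'M[K]_#|{: n.-bseq bool}| :=
    \matrix_(i, j) (- (word_of i == a :: word_of j)%:R) in
  Conn (N false) (N true).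

Lemma word_of_inj : injective word_of.
Proof. by move=> i j /val_inj /enum_val_inj. Qed.

Lemma word_of_rank w : word_of (enum_rank w) = bseqval w.
Proof. by rewrite /word_of enum_rankK. Qed.

Lemma residue_word_conn a i j : residue word_conn (letter_cusp a) i j =
  - (word_of i == a :: word_of j)%:R.
Proof. by case: a => /=; rewrite mxE. Qed.

Lemma wordmx_word_conn u i j : wordmx word_conn u i j =
  (word_of i == u ++ word_of j)%:R.
Proof.
elim: u i => [|a u IH] i /=.
  by rewrite mxE (inj_eq word_of_inj).
rewrite mxE; have [hu|hu] := leqP (size (u ++ word_of j)) n; last first.
  rewrite big1 => [|k _].
    have [/(congr1 size) /= h|//] := eqVneq.
    by have := size_bseq (enum_val i); rewrite h ltnNge ltnW.
  rewrite IH; have [/(congr1 size) h|_] := eqVneq; last by rewrite mulr0.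
  by have := size_bseq (enum_val k); rewrite h leqNgt hu.
rewrite (bigD1 (enum_rank (Bseq hu))) //= big1 ?addr0 => [|k kj].
  by rewrite IH mxE residue_word_conn word_of_rank /= eqxx opprK mulr1.
rewrite IH; have [h|_] := eqVneq (word_of k); last by rewrite mulr0.
case/eqP: kj.
by apply: word_of_inj; rewrite word_of_rank.
Qed.

Lemma wordmx_word_conn0 w : (n < size w)%N -> wordmx word_conn w = 0.
Proof.
move=> nw; apply/matrixP => i j.
rewrite wordmx_word_conn mxE; have [/(congr1 size) h|//] := eqVneq.
have := size_bseq (enum_val i); rewrite -/(word_of i) h size_cat.
by move/(leq_trans (leq_addr _ _)); rewrite leqNgt nw.
Qed.

Lemma unipotent_word_conn : unipotent word_conn.
Proof. exact: wordmx0_unipotent wordmx_word_conn0. Qed.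

Definition word_object : ncDR K := NCDR unipotent_word_conn.

Definition word_index (w : seq bool) : 'I_(rk word_object) :=
  enum_rank (insub_bseq n w).

Lemma word_of_index w : (size w <= n)%N -> word_of (word_index w) = w.
Proof. by move=> h; rewrite word_of_rank /= /insub_bseq insubdK. Qed.

End UniversalObject.

Section Embedding.
Variables (K L : fieldType) (iota : {rmorphism K -> L}).
Local Notation "A ^i" := (map_mx iota A) (at level 2, format "A ^i").
Local Notation loop := (dR_path iota (t01 K) (t01 K)).

(* The embedding i: the coefficient of w in i(g) is that of w in g(1), for the
   action of g on K<<A,B>> truncated at length |w|.  By iDR_action, g acts on
   every object as the series i(g) evaluated at A = -Res_0, B = -Res_1; by
   iDR_x, iDR_y and iDR_comp, i is the group embedding with x |-> e^A and
   y |-> e^B. *)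
Definition iDR (g : loop) : ncseries L := fun w =>
  g (word_object K (size w)) (word_index K (size w) w)
                             (word_index K (size w) [::]).

Lemma path_word_object (g : loop) (M : ncDR K) n :
  (forall w, (n < size w)%N -> wordmx M w = 0) ->
  g M = \sum_k g (word_object K n) k (word_index K n [::])
          *: (wordmx M (word_of k))^i.
Proof.
move=> Mn; apply/matrixP => r j.
pose f : 'M[K]_(rk M, rk (word_object K n)) :=
  \matrix_(r, k) wordmx M (word_of k) r j.
have hf a : f *m residue (word_object K n) (letter_cusp a)
          = residue M (letter_cusp a) *m f.
  apply/matrixP => s k.
  transitivity (- wordmx M (a :: word_of k) s j); last first.
    by rewrite /= mulNmx !mxE opprK; apply: eq_bigr => l _; rewrite mxE.
  rewrite mxE; have [hk|hk] := leqP (size (a :: word_of k)) n; last first.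
    rewrite Mn // mxE oppr0 big1 // => l _; rewrite residue_word_conn.
    have [h|_] := eqVneq (word_of l); last by rewrite oppr0 mulr0.
    by have := size_bseq (enum_val l); rewrite -/(word_of l) h leqNgt hk.
  rewrite (bigD1 (word_index K n (a :: word_of k))) //= big1 ?addr0 => [|l hl].
    by rewrite residue_word_conn word_of_index // eqxx mulrN1 mxE word_of_index.
  rewrite residue_word_conn; have [h|_] := eqVneq (word_of l).
    by case/eqP: hl; apply: word_of_inj; rewrite word_of_index.
  by rewrite oppr0 mulr0.
have {}hf : horizontal f by apply: horizontalP; [exact: (hf false)|exact: (hf true)].
have := path_natural g hf => /matrixP /(_ r (word_index K n [::])).
rewrite mxE => e; transitivity ((g M *m f^i) r (word_index K n [::])).
  rewrite mxE (bigD1 j) //= big1 ?addr0 => [|s sj].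
    by rewrite !mxE word_of_index // mxE eqxx rmorph1 mulr1.
  by rewrite !mxE word_of_index // mxE (negbTE sj) rmorph0 mulr0.
rewrite -e summxE; apply: eq_bigr => k _.
by rewrite !mxE mulrC.
Qed.

Lemma iDR_index (g : loop) n w : (size w <= n)%N ->
  g (word_object K n) (word_index K n w) (word_index K n [::]) = iDR g w.
Proof.
move=> wn; rewrite /iDR (@path_word_object _ (word_object K (size w)) n); last first.
  by move=> u nu; apply: wordmx_word_conn0; exact: leq_ltn_trans nu.
rewrite summxE (bigD1 (word_index K n w)) //= big1 ?addr0 => [|k kw].
  rewrite !mxE wordmx_word_conn !word_of_index // cats0 eqxx.
  by rewrite rmorph1 mulr1.
rewrite !mxE wordmx_word_conn !word_of_index // cats0.
have [h|_] := eqVneq w; last by rewrite rmorph0 mulr0.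
by case/eqP: kw; apply: word_of_inj; rewrite word_of_index.
Qed.

Lemma iDR_action (g : loop) (M : ncDR K) n :
  (forall w, (n < size w)%N -> wordmx M w = 0) ->
  g M = \sum_(w : n.-bseq bool) iDR g w *: (wordmx M w)^i.
Proof.
move=> /path_word_object ->.
rewrite (reindex (enum_val : 'I_#|{: n.-bseq bool}| -> _)) /=; last first.
  by exists enum_rank => x _; rewrite ?enum_valK ?enum_rankK.
apply: eq_bigr => k _; rewrite -/(word_of k); congr (_ *: _).
rewrite -(@iDR_index g n) ?size_bseq //; congr (g _ _ _).
by apply: word_of_inj; rewrite word_of_index // size_bseq.
Qed.

Lemma iDR_inj : injective iDR.
Proof.
move=> g h gh; apply: dR_path_eq => M.
have M0 w : (rk M < size w)%N -> wordmx M w = 0.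
  by move/ltnW; apply: unipotent_wordmx0; exact: ncDR_unipotent.
by rewrite (iDR_action g M0) (iDR_action h M0) gh.
Qed.

Lemma iDR_can : iDR (path_can iota _ _) = nc1 L.
Proof.
apply/funext => w; rewrite /iDR /= mxE /nc1.
by rewrite -(inj_eq (@word_of_inj _)) !word_of_index.
Qed.

Lemma iDR_comp (h g : loop) : iDR (path_comp h g) = ncmul (iDR h) (iDR g).
Proof.
apply/funext => w; rewrite {1}/iDR /= mxE /ncmul.
set n := size w.
have n0 u : (n < size u)%N -> wordmx (word_object K n) u = 0.
  exact: wordmx_word_conn0.
have split_size (u : n.-bseq bool) v : w = u ++ v -> (n - size v)%N = size u.
  by move/(congr1 size); rewrite size_cat => /esym/(canRL (addnK _)).
have hE j : h (word_object K n) (word_index K n w) j =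
    if drop (n - size (word_of j)) w == word_of j
    then iDR h (take (n - size (word_of j)) w) else 0.
  rewrite (iDR_action h n0) summxE.
  under eq_bigr => u _ do rewrite !mxE wordmx_word_conn rmorph_nat word_of_index //.
  case: eqP => [dj|dj].
    have hu : (size (take (n - size (word_of j)) w) <= n)%N.
      by rewrite size_take_min geq_minr.
    rewrite (bigD1 (Bseq hu)) //= big1 ?addr0 => [|u hw].
      by rewrite -{3}dj cat_take_drop eqxx mulr1.
    have [wE|_] := eqVneq w; last by rewrite mulr0.
    case/eqP: hw; apply: val_inj => /=.
    by rewrite (split_size _ _ wE) [X in take _ X]wE take_size_cat.
  rewrite big1 // => u _; have [wE|_] := eqVneq w; last by rewrite mulr0.
  by case: dj; rewrite (split_size _ _ wE) [X in drop _ X]wE drop_size_cat.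
have gE j : g (word_object K n) j (word_index K n [::]) = iDR g (word_of j).
  rewrite -(@iDR_index g n) ?size_bseq //; congr (g _ _ _).
  by apply: word_of_inj; rewrite word_of_index // size_bseq.
under eq_bigr => j _ do rewrite hE gE (fun_if (fun x => x * _)) mul0r.
rewrite -big_mkcond /=.
have dn k : (size (drop k w) <= n)%N by rewrite size_drop leq_subr.
rewrite (reindex_onto (fun k : 'I_n.+1 => word_index K n (drop k w))
  (fun j => inord (n - size (word_of j)))) => [|j /eqP dj].
  have kn (k : 'I_n.+1) : (n - size (drop k w))%N = k.
    by rewrite size_drop subKn // -ltnS.
  apply: eq_big => k; rewrite (word_of_index K (dn k)) kn //.
  by rewrite inord_val !eqxx.
apply: word_of_inj; rewrite (word_of_index K (dn _)).
by rewrite inordK ?dj // ltnS leq_subr.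
Qed.

End Embedding.

Section ImageOfGenerators.
Variables (K : fieldType) (L : numFieldType) (iota : {rmorphism K -> L}).
Local Notation "A ^i" := (map_mx iota A) (at level 2, format "A ^i").

Lemma expmx_residue_word (a : bool) w :
  expmx (- (residue (word_object K (size w)) (letter_cusp a))^i)
    (word_index K (size w) w) (word_index K (size w) [::]) = ncexp (ncvar L a) w.
Proof.
set n := size w; set X := - _.
have Xpow k : X ^+ k = (wordmx (word_object K n) (nseq k a))^i.
  by rewrite /X -map_mxN -expr_wordmx -[RHS]/(map_mx iota _) rmorphXn.
have Xn : X ^+ n.+1 = 0.
  by rewrite Xpow wordmx_word_conn0 ?map_mx0 // size_nseq.
have Xrk : X ^+ rk (word_object K n) = 0 by exact: residue_nilpotent.
rewrite (expmx_trunc Xrk Xn) /ncexp big_mkord summxE; apply: eq_bigr => k _.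
rewrite Xpow ncpow_var !mxE wordmx_word_conn !word_of_index // cats0.
by rewrite rmorph_nat.
Qed.

Lemma iDR_x : iDR (path_x iota) = ncexp (ncA L).
Proof. by apply/funext => w; exact: expmx_residue_word. Qed.

Lemma iDR_y : iDR (path_y iota) = ncexp (ncB L).
Proof.
apply/funext => w; rewrite -expmx_residue_word /iDR /=.
by rewrite invmx1 mul1mx mulmx1.
Qed.

End ImageOfGenerators.

Local Open Scope complex_scope.
Local Open Scope ring_scope.

Section Analysis.
Variable R : realType.
Local Notation C := (R[i]).

(* Derivative of a complex-valued function of a real variable. *)
Definition cderive (f : R -> C) (t : R) (l : C) : Prop :=
  is_derive t 1 (fun u => complex.Re (f u)) (complex.Re l) /\
  is_derive t 1 (fun u => complex.Im (f u)) (complex.Im l).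

(* derivable over the scalar field C^o is complex differentiability. *)
Definition holomorphic_on_disc (r : R) (f : C -> C) : Prop :=
  forall z : C, `|z| < r%:C -> derivable (f : C^o -> C^o) z 1.

End Analysis.

Section BettiPath.
Variables (R : realType) (K : fieldType) (iota : {rmorphism K -> R[i]}).
Local Notation C := (R[i]).
Local Notation "A ^i" := (map_mx iota A) (at level 2, format "A ^i").

Definition connection_form (M : conn K) (t : R) : 'M[C]_(rk M) :=
  (t^-1)%:C *: (residue M cusp0)^i + ((t - 1)^-1)%:C *: (residue M cusp1)^i.

(* Sections over the real path 0 < t < 1 of the local system of solutions of
   (d + omega) sigma = 0. *)
Definition flat_section (M : conn K) (sigma : R -> 'cV[C]_(rk M)) : Prop :=
  forall t, 0 < t < 1 -> forall j,
    cderive (fun u => sigma u j 0) t (- (connection_form M t *m sigma t) j 0).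

Definition local_coordinate (a : bool) (t : R) : R := if a then 1 - t else t.

(* The comparison isomorphism at the tangential base point t_s = 1: near s,
   sigma = P(t_s) t_s^(-Res_s omega) v with P holomorphic and P(0) = 1. *)
Definition tangential_value (M : conn K) (a : bool)
    (sigma : R -> 'cV[C]_(rk M)) (v : 'cV[C]_(rk M)) : Prop :=
  exists (r : R) (P : C -> 'M[C]_(rk M)),
    [/\ 0 < r,
        forall i j, holomorphic_on_disc r (fun z => P z i j),
        P 0 = 1%:M &
        forall t, 0 < t < 1 -> local_coordinate a t < r ->
          sigma t = P (local_coordinate a t)%:C
            *m expmx (- (ln (local_coordinate a t))%:C *:
                        (residue M (letter_cusp a))^i) *m v].

(* b is the image under the comparison isomorphism of the topological path
   (0, 1), which carries a flat section near 0 to its continuation near 1. *)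
Definition is_betti_path (b : dR_path iota (t01 K) (t10 K)) : Prop :=
  forall (M : ncDR K) (v : 'cV[C]_(rk M)),
    exists sigma : R -> 'cV[C]_(rk M),
      [/\ flat_section sigma,
          tangential_value false sigma v &
          tangential_value true sigma (b M *m v)].

End BettiPath.

Section DrinfeldAssociator.
Variable R : realType.
Local Notation C := (R[i]).

Definition KZ_form (z : R) : ncseries C :=
  ncadd (ncscale (z^-1)%:C (ncA C)) (ncscale ((z - 1)^-1)%:C (ncB C)).

(* The second clause is G_0(z) ~ z^A: G_0(z) z^(-A) extends to H, holomorphic
   near 0 with H(0) = 1. *)
Definition is_G0 (G : R -> ncseries C) : Prop :=
  (forall z, 0 < z < 1 -> forall w,
     cderive (fun u => G u w) z (ncmul (KZ_form z) (G z) w)) /\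
  exists (r : R) (H : C -> ncseries C),
    [/\ 0 < r,
        forall w, holomorphic_on_disc r (fun z => H z w),
        H 0 = nc1 C &
        forall z, 0 < z < 1 -> z < r ->
          ncmul (G z) (ncexp (ncscale (- ln z)%:C (ncA C))) = H z%:C].

(* Phi = lim exp(- log eps B) G_0(1 - eps), coefficient by coefficient. *)
Definition is_PhiKZ (Phi : ncseries C) : Prop :=
  exists2 G : R -> ncseries C, is_G0 G &
    forall w, ncmul (ncexp (ncscale (- ln eps)%:C (ncB C))) (G (1 - eps)) w
                @[eps --> 0^'+] --> (Phi w : C^o).

End DrinfeldAssociator.

(* Main.v *)
Require Import Defs.
From mathcomp Require Import all_boot all_order all_algebra.
From mathcomp Require Import complex mxtens ring lra.
From mathcomp Require Import all_classical all_reals all_analysis.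
Set Implicit Arguments.
Unset Strict Implicit.
Unset Printing Implicit Defensive.
Import Order.TTheory GRing.Theory Num.Theory numFieldNormedType.Exports.
Local Open Scope classical_set_scope.
Local Open Scope complex_scope.
Local Open Scope ring_scope.

(* On an object M with A = -Res_0 and B = -Res_1, horizontal sections are the
   solutions of dG/dz = (A/z + B/(z-1)) G, so evaluating a series solution at A
   and B gives horizontal sections.  Let G_0 and G_1 be the series solutions
   with G_0 = H_0(z) z^A and G_1 = H_1(1-z) (1-z)^B, H_0 and H_1 being power
   series with constant term 1.  They differ by a constant, G_0 = G_1 Phi; the
   tangential values at 0 and 1 of the section G_0 v are then v and Phi v, so
   b acts as Phi, while exp(-log eps B) G_0(1 - eps) =
   eps^(-B) H_1(eps) eps^B Phi tends to Phi.
   If every linear combination of the entries of a solution that is constant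
   vanishes, then the solution is zero, by nilpotence; this gives uniqueness of
   G_0 and of b, and the compatibility of b with tensor products. *)

(** * Noncommutative formal series *)

(** Near a cusp a solution is a holomorphic factor times e^N with N nilpotent, so agreement of
    leading terms controls a difference only up to powers of log e. Comparisons are therefore made
    in a class of functions that absorbs such powers. The local solution must be complex
    differentiable on a disc and also satisfy a real differential equation on the interval. Both are
    drawn from a single explicit second-order remainder estimate for power series whose coefficients
    grow at most linearly. The Taylor coefficients at a word w are bounded by 3^|w|, whatever their
    index, so the unit disc serves for all words at once. The cusp 1 costs nothing new: t -> 1 - t
    exchanges the letters A and B. Truncation depths are kept flexible because a product of
    truncations agrees with the truncation of the product only after such words are discarded. *)

Section SeriesAlgebra.
Variable L : fieldType.
Implicit Types (S T U : ncseries L) (a b : bool) (u w : seq bool).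

(** The left quotient of [S] by the letter [b]: S is its constant term plus A times its quotient by
    A plus B times its quotient by B. Products unfold along it one letter at a time, which turns the
    ring laws into inductions on the word. *)
Definition ncshift b S : ncseries L := fun w => S (b :: w).

Lemma ncmul_nil S T : ncmul S T [::] = S [::] * T [::].
Proof. by rewrite /ncmul big_ord_recl big_ord0 addr0. Qed.

Lemma ncmul_cons S T b w :
  ncmul S T (b :: w) = S [::] * T (b :: w) + ncmul (ncshift b S) T w.
Proof. by rewrite /ncmul big_ord_recl. Qed.

Lemma ncmulDl S T U : ncmul (ncadd S T) U = ncadd (ncmul S U) (ncmul T U).
Proof.
apply/funext => w; rewrite /ncadd /ncmul -big_split.
by apply: eq_bigr => i _; rewrite mulrDl.
Qed.

Lemma ncmulDr S T U : ncmul U (ncadd S T) = ncadd (ncmul U S) (ncmul U T).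
Proof.
apply/funext => w; rewrite /ncadd /ncmul -big_split.
by apply: eq_bigr => i _; rewrite mulrDr.
Qed.

Lemma ncmulZl c S T : ncmul (ncscale c S) T = ncscale c (ncmul S T).
Proof.
apply/funext => w; rewrite /ncscale /ncmul mulr_sumr.
by apply: eq_bigr => i _; rewrite mulrA.
Qed.

Lemma ncmulZr c S T : ncmul S (ncscale c T) = ncscale c (ncmul S T).
Proof.
apply/funext => w; rewrite /ncscale /ncmul mulr_sumr.
by apply: eq_bigr => i _; rewrite mulrCA.
Qed.

Lemma ncshift_mul b S T :
  ncshift b (ncmul S T) = ncadd (ncscale (S [::]) (ncshift b T)) (ncmul (ncshift b S) T).
Proof. by apply/funext => w; rewrite /ncshift ncmul_cons. Qed.

Lemma ncmulA S T U : ncmul S (ncmul T U) = ncmul (ncmul S T) U.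
Proof.
apply/funext => w; elim: w S => [|b w IH] S; first by rewrite !ncmul_nil mulrA.
rewrite !ncmul_cons ncshift_mul ncmulDl ncmulZl ncmul_nil IH /ncadd /ncscale.
by rewrite mulrDr !mulrA -addrA.
Qed.

Lemma ncmul1l S : ncmul (nc1 L) S = S.
Proof.
apply/funext => -[|b w]; first by rewrite ncmul_nil mul1r.
rewrite ncmul_cons mul1r /ncmul big1 ?addr0 // => i _.
by rewrite /ncshift /nc1 mul0r.
Qed.

Lemma ncmul1r S : ncmul S (nc1 L) = S.
Proof.
apply/funext => w; elim: w S => [|b w IH] S; first by rewrite ncmul_nil mulr1.
by rewrite ncmul_cons IH /nc1 mulr0 add0r.
Qed.

Lemma ncmul_varr a S u b :
  ncmul S (ncvar L a) (rcons u b) = (b == a)%:R * S u.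
Proof.
elim: u S => [|c u IH] S /=; rewrite ncmul_cons.
  by rewrite ncmul_nil /ncvar eqseq_cons andbT mulr0 addr0 mulrC.
rewrite IH /ncvar eqseq_cons; case: u {IH} => [|d u];
  by rewrite ?andbF mulr0 add0r.
Qed.

Lemma ncpowZ c S k : ncpow (ncscale c S) k = ncscale (c ^+ k) (ncpow S k).
Proof.
elim: k => [|k IH]; first by apply/funext => w; rewrite /ncscale mul1r.
rewrite /ncpow !iterS -!/(ncpow _ k) IH ncmulZl ncmulZr.
by apply/funext => w; rewrite /ncscale mulrA -exprS.
Qed.

Lemma nseq_sizeE a w : (w == nseq (size w) a) = all (pred1 a) w.
Proof.
by elim: w => [|b w IH] //=; rewrite eqseq_cons IH.
Qed.

Lemma ncexp_var c a w :
  ncexp (ncscale c (ncvar L a)) w = c ^+ size w / (size w)`!%:R * (all (pred1 a) w)%:R.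
Proof.
rewrite /ncexp big_ord_recr /= big1 ?add0r => [|[k kw] _ /=].
  by rewrite ncpowZ /ncscale ncpow_var nseq_sizeE mulrA [_ / _]mulrC.
rewrite ncpowZ /ncscale ncpow_var; have [we|] := eqVneq; last by rewrite !mulr0.
by move: kw; rewrite we size_nseq ltnn.
Qed.

Lemma ncshift_var a b : ncshift b (ncvar L a) = ncscale (b == a)%:R (nc1 L).
Proof.
by apply/funext => w; rewrite /ncshift /ncvar /ncscale /nc1 eqseq_cons -natrM mulnb.
Qed.

(** The solution is the fixed point of V -> T - (S - 1) V. The right-hand side at [w] reads V only
    at strictly shorter words, since S - 1 has no constant term; so the iterates stabilise at [w]
    after |w| + 1 rounds. *)
Lemma ncsolve S T : S [::] = 1 -> exists U, ncmul S U = T.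
Proof.
move=> S0.
pose step (V : ncseries L) : ncseries L := fun w =>
  T w - \sum_(i < size w) S (take i.+1 w) * V (drop i.+1 w).
have stepE V V' w : (forall u, (size u < size w)%N -> V u = V' u) ->
    step V w = step V' w.
  move=> VV'; congr (_ - _); apply: eq_bigr => i _; congr (_ * _); apply: VV'.
  rewrite size_drop; case: (size w) i => [[]//|n] i.
  by rewrite subSS ltnS leq_subr.
have stab k w : (size w < k)%N -> iter k step T w = step (iter k step T) w.
  elim: k w => [//|k IH] w wk; rewrite iterS; apply: stepE => u uw.
  apply: IH; exact: leq_trans uw _.
have stab2 k l w : (size w < k)%N -> (size w < l)%N ->
    iter k step T w = iter l step T w.
  elim: {w}(size w) {-2}w (leqnn (size w)) => [|n IH] w wn wk wl;
    rewrite stab // (stab l) //; apply: stepE => u uw; first by move: (leq_trans uw wn).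
  by apply: IH; [exact: leq_trans uw wn|exact: ltn_trans uw wk|exact: ltn_trans uw wl].
exists (fun w => iter (size w).+1 step T w); apply/funext => w.
rewrite /ncmul big_ord_recl take0 drop0 S0 mul1r stab // {1}/step.
apply/eqP; rewrite -addrA -subr_eq0 addrAC subrr add0r addrC subr_eq0; apply/eqP.
apply: eq_bigr => i _; congr (_ * _); apply: stab2; first by [].
by rewrite ltnS size_drop leq_subr.
Qed.

End SeriesAlgebra.

Lemma ncexp_varD (L : numFieldType) (c d : L) a :
  ncmul (ncexp (ncscale c (ncvar L a))) (ncexp (ncscale d (ncvar L a))) =
  ncexp (ncscale (c + d) (ncvar L a)).
Proof.
apply/funext => w; rewrite [RHS]ncexp_var exprDn mulr_suml mulr_suml /ncmul.
(* The prefix of length i carries c^i, whereas [exprDn] attaches the index to the power of d; hence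
   the reversal. *)
rewrite [RHS](reindex_inj rev_ord_inj) /=.
apply: eq_bigr => -[i /= iw] _; rewrite !ncexp_var size_drop.
have {}iw : (i <= size w)%N by [].
have -> : all (pred1 a) w = all (pred1 a) (take i w) && all (pred1 a) (drop i w).
  by rewrite -all_cat cat_take_drop.
rewrite subSS subKn // size_takel // -mulnb natrM -[_ *+ 'C(_, _)]mulr_natr bin_sub //.
have fn0 k : (k`!%:R : L) != 0 by rewrite pnatr_eq0 -lt0n fact_gt0.
have -> : ('C(size w, i)%:R : L) = (size w)`!%:R / (i`!%:R * (size w - i)`!%:R).
  by rewrite -(bin_fact iw) !natrM mulfK // mulf_neq0.
by field; rewrite !fn0.
Qed.

Lemma ncexp_var0 (L : numFieldType) a : ncexp (ncscale 0 (ncvar L a)) = nc1 L.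
Proof.
apply/funext => -[|b w]; rewrite ncexp_var; first by rewrite expr0 fact0 divr1 mulr1.
by rewrite expr0n /= !mul0r.
Qed.

(** * Power series *)

Section QuadraticRemainder.
Variable F : numFieldType.

(** Multiplying the remainder of one exponent by z + h misses the remainder of the next by (n+2) h^2
    z^(n+1) only, and the two bounds add up by Pascal's rule. The explicit dependence on n is what
    makes the estimate summable over a power series. *)
Lemma exprD_quad_remainder (z h rho : F) n : `|z| <= rho -> `|z + h| <= rho ->
  `|(z + h) ^+ n.+2 - z ^+ n.+2 - n.+2%:R * h * z ^+ n.+1| <=
  'C(n.+2, 2)%:R * `|h| ^+ 2 * rho ^+ n.
Proof.
move=> zr zhr; have r0 : 0 <= rho by exact: le_trans zr.
elim: n => [|n IH].
  rewrite expr1 expr0 mulr1 binn mul1r -normrX.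
  by rewrite (_ : _ - _ = h ^+ 2) //; ring.
set D := (X in `|X| <= _) in IH.
have -> : (z + h) ^+ n.+3 - z ^+ n.+3 - n.+3%:R * h * z ^+ n.+2 =
    (z + h) * D + n.+2%:R * (h ^+ 2 * z ^+ n.+1).
  by rewrite /D !exprS; ring.
apply: le_trans (ler_normD _ _) _; rewrite binS bin1.
rewrite [(_ + _)%:R]natrD [_ * `|h| ^+ 2]mulrDl [leRHS]mulrDl lerD //.
  by rewrite normrM [rho ^+ _]exprS mulrCA; apply: ler_pM.
rewrite -[leRHS]mulrA normrM normr_nat normrM !normrX.
by rewrite ler_wpM2l ?ler0n // ler_wpM2l ?exprn_ge0 // lerXn2r ?nnegrE.
Qed.

(** Stated over any [numFieldType] because it serves twice: over the complex numbers for holomorphy,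
    over the reals for derivatives along the interval. *)
Lemma quad_remainder_is_derive (f : F -> F) (z l K d : F) : 0 < d ->
  (forall h, `|h| < d -> `|f (z + h) - f z - h * l| <= K * `|h| ^+ 2) ->
  is_derive z 1 f l.
Proof.
move=> d0 fz.
(* Testing the bound at the nonzero increment [d / 2] forces the sign of [K]; [K + 1] is then a safe
   divisor even when [K] vanishes. *)
have K0 : 0 <= K.
  have h0 : 0 < d / 2 by rewrite divr_gt0.
  have /fz : `|d / 2| < d by rewrite gtr0_norm // ltr_pdivrMr // ltr_pMr // ltr1n.
  move/(le_trans (normr_ge0 _)); rewrite pmulr_lge0 // exprn_gt0 //.
  by rewrite normr_gt0 lt0r_neq0.
have K1 : 0 < K + 1 by exact: ltr_pwDr.
have fl : (fun h => h^-1 *: (f (h *: 1 + z) - f z)) @ 0^' --> l.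
  apply/cvgrPdist_le => e e0; near=> h.
  have h0 : h != 0 by near: h; exact: nbhs_dnbhs_neq.
  have nh0 : 0 < `|h| by rewrite normr_gt0.
  rewrite distrC.
  have -> : h^-1 *: (f (h *: 1 + z) - f z) - l = h^-1 * (f (z + h) - f z - h * l).
    by rewrite [_ *: 1]mulr1 [h + z]addrC mulrBr mulKf.
  rewrite normrM normfV mulrC ler_pdivrMr //.
  have hd : `|h| < d.
    by near: h; apply: dnbhs0_lt.
  apply: le_trans (fz _ hd) _; rewrite expr2 mulrA ler_pM2r //.
  have : `|h| <= e / (K + 1).
    by near: h; apply: dnbhs0_le; exact: divr_gt0.
  rewrite ler_pdivlMr // mulrC; apply: le_trans.
  by rewrite ler_wpM2r // lerDl.
by apply: DeriveDef; [apply/cvg_ex; exists l | exact: cvg_lim].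
Unshelve. all: by end_near.
Qed.

End QuadraticRemainder.

(** These are partial sums, with nonnegative terms, of the expansion of (1 - rho)^(-p-1).
    Multiplication by 1 - rho lowers p by one, by Pascal's rule, up to a boundary term of favourable
    sign. *)
Lemma binomial_series_bound (F : numFieldType) (rho : F) p N : 0 <= rho < 1 ->
  \sum_(n < N) 'C(n + p, p)%:R * rho ^+ n <= (1 - rho) ^- p.+1.
Proof.
move=> /andP[r0 r1]; have r1' : 0 < 1 - rho by rewrite subr_gt0.
elim: p => [|p IH].
  have -> : \sum_(n < N) 'C(n + 0, 0)%:R * rho ^+ n = \sum_(n < N) rho ^+ n.
    by apply: eq_bigr => n _; rewrite bin0 mul1r.
  rewrite expr1 -[leRHS]mul1r ler_pdivlMr // mulrC.
  rewrite -opprB mulNr -subrX1 opprB lerBlDr lerDl exprn_ge0 //.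
rewrite exprS invfM mulrC -ler_pdivrMr ?invr_gt0 // invrK mulrC.
apply: le_trans IH.
suff -> : \sum_(n < N) 'C(n + p, p)%:R * rho ^+ n =
  (1 - rho) * (\sum_(n < N) 'C(n + p.+1, p.+1)%:R * rho ^+ n)
  + 'C(N + p, p.+1)%:R * rho ^+ N.
  by rewrite lerDl mulr_ge0 ?exprn_ge0 // ler0n.
elim: N => [|N IHN]; first by rewrite !big_ord0 bin_small // mulr0 mul0r addr0.
rewrite !big_ord_recr /= IHN addnS addSn binS natrD exprS.
by ring.
Qed.

Section PowerSeries.
Variable F : numFieldType.
Implicit Types (a b : nat -> F) (z s t c : F).

(** A relation, so that convergence is part of every statement and the algebra of sums needs no
    completeness of [F]; existence is proved over the complex numbers only. *)
Definition psum a z s := series (fun k => a k * z ^+ k) @ \oo --> s.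

Lemma psum_unique a z s t : psum a z s -> psum a z t -> s = t.
Proof. by move=> h1 h2; apply: cvg_unique h1 h2; exact: norm_hausdorff. Qed.

Lemma psumD a b z s t :
  psum a z s -> psum b z t -> psum (fun k => a k + b k) z (s + t).
Proof.
move=> ha hb; rewrite /psum.
have -> : series (fun k => (a k + b k) * z ^+ k) =
   series (fun k => a k * z ^+ k) + series (fun k => b k * z ^+ k).
  by rewrite -seriesD; congr series; apply/funext => k; rewrite mulrDl.
exact: cvgD.
Qed.

Lemma psumZ c a z s : psum a z s -> psum (fun k => c * a k) z (c * s).
Proof.
move=> ha; rewrite /psum.
have -> : series (fun k => c * a k * z ^+ k) = c *: series (fun k => a k * z ^+ k).
  by rewrite -seriesZ; congr series; apply/funext => k; rewrite -mulrA.
exact: cvgZl_tmp.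
Qed.

Lemma psumB a b z s t :
  psum a z s -> psum b z t -> psum (fun k => a k - b k) z (s - t).
Proof.
move=> ha hb; have := psumD ha (psumZ (c := -1) hb); rewrite mulN1r; congr psum.
by apply/funext => k; rewrite mulN1r.
Qed.

Lemma psum_recl a z s :
  psum (fun k => a k.+1) z s -> psum a z (a 0%N + z * s).
Proof.
move=> ha; rewrite /psum -cvg_shiftS.
have -> : [sequence series (fun k => a k * z ^+ k) n.+1]_n =
    cst (a 0%N) + z *: series (fun k => a k.+1 * z ^+ k).
  apply/funext => n; rewrite /series /= big_nat_recl // expr0 mulr1.
  congr (_ + _); rewrite -[RHS]/(_ * _) mulr_sumr; apply: eq_bigr => k _.
  by rewrite exprS mulrCA.
by apply: cvgD; [exact: cvg_cst|exact: cvgZl_tmp].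
Qed.

Lemma lim_norm_le (u : nat -> F) l B :
  u @ \oo --> l -> (forall n, `|u n| <= B) -> `|l| <= B.
Proof.
move=> /cvgrPdist_le ul uB; apply/ler_addgt0Pr => e /ul [N _ /(_ N (leqnn N))] h.
have -> : l = u N + (l - u N) by rewrite addrC subrK.
exact: le_trans (ler_normD _ _) (lerD (uB _) h).
Qed.

(** Termwise differentiation with a quantitative error: the quadratic remainders of the monomials
    are summed against the coefficients, and the bound passes to the limit of the partial sums. *)
Lemma psum_remainder a (M : F) f g z :
  (forall n, `|a n| <= M * n.+1%:R) ->
  (forall z, `|z| < 1 -> psum a z (f z)) ->
  (forall z, `|z| < 1 -> psum (fun n => n.+1%:R * a n.+1) z (g z)) ->
  `|z| < 1 -> exists d, exists2 K, 0 < d &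
  forall h, `|h| < d -> `|f (z + h) - f z - h * g z| <= K * `|h| ^+ 2.
Proof.
(* The midpoint of |z| and 1: increments smaller than [rho] - |z| stay in a disc of radius less than
   1. *)
move=> aM hf hg z1; pose rho := (`|z| + 1) / 2.
have [r1 zr] : rho < 1 /\ `|z| < rho.
  by rewrite /rho ltr_pdivrMr // ltr_pdivlMr // !mulr_natr !mulr2n ltrD2r ltrD2l.
have M0 : 0 <= M by have := le_trans (normr_ge0 _) (aM 0%N); rewrite mulr1.
have r0 : 0 <= rho by rewrite divr_ge0 // addr_ge0.
(* The coefficient of index k + 2 is at most M (k+3), and (k+3) C(k+2, 2) = 3 C(k+3, 3); summing
   C(k+3, 3) rho^k gives the exponent 4. *)
exists (rho - `|z|), (3 * M * (1 - rho) ^- 4); first by rewrite subr_gt0.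
move=> h hd; have zhr : `|z + h| <= rho.
  by apply: le_trans (ler_normD _ _) _; rewrite addrC -lerBrDr ltW.
have zh1 := le_lt_trans zhr r1.
(* [D] vanishes for exponents 0 and 1. Taking n + 2 terms of f against n + 1 terms of g aligns the
   indices, so that [u n] is a sum starting at the coefficient of index 2. *)
pose D n := (z + h) ^+ n - z ^+ n - n%:R * h * z ^+ n.-1.
pose u n := series (fun k => a k * (z + h) ^+ k) n.+2
  - series (fun k => a k * z ^+ k) n.+2
  - h * series (fun k => k.+1%:R * a k.+1 * z ^+ k) n.+1.
have uE n : u n = \sum_(k < n) a k.+2 * D k.+2.
  have {1}-> : u n = \sum_(k < n.+2) a k * D k.
    rewrite /u /series /= !big_mkord mulr_sumr.
    rewrite [X in _ - X](_ : _ = \sum_(k < n.+2) a k * (k%:R * h * z ^+ k.-1)).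
      by rewrite -!sumrB; apply: eq_bigr => k _; rewrite /D; ring.
    rewrite [RHS]big_ord_recl !mul0r mulr0 add0r; apply: eq_bigr => k _ /=.
    by rewrite /bump /= add1n; ring.
  rewrite 2!big_ord_recl /D /= /bump /= !expr0 subrr !mul0r subr0 mulr0 add0r.
  by rewrite expr1 mulr1 mul1r -addrA -opprD subrr mulr0 add0r.
apply: (@lim_norm_le u) => [|n].
  have := hg _ z1; rewrite /psum -cvg_shiftS => h1.
  have := hf _ z1; rewrite /psum -(cvg_shiftn 2) => h2.
  have := hf _ zh1; rewrite /psum -(cvg_shiftn 2) => h3.
  apply: (cvg_trans _ (cvgB (cvgB h3 h2) (cvgZl_tmp (k := h) h1))).
  apply: near_eq_cvg; near=> k.
  by rewrite -[LHS]/(series _ (k + 2)%N - series _ (k + 2)%N - h * _) addn2.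
rewrite uE; apply: le_trans (ler_norm_sum _ _ _) _.
apply: (@le_trans _ _ (\sum_(k < n) 3 * M * `|h| ^+ 2 * ('C(k + 3, 3)%:R * rho ^+ k))).
  apply: ler_sum => k _; rewrite normrM.
  apply: (@le_trans _ _ (M * k.+3%:R * ('C(k.+2, 2)%:R * `|h| ^+ 2 * rho ^+ k))).
    by apply: ler_pM => //; apply: exprD_quad_remainder => //; exact: ltW.
  rewrite addn3 le_eqVlt; apply/orP; left; apply/eqP.
  have e : k.+3%:R * 'C(k.+2, 2)%:R = 3 * 'C(k.+3, 3)%:R :> F.
    by rewrite -!natrM mul_bin_diag.
  transitivity (M * (k.+3%:R * 'C(k.+2, 2)%:R) * `|h| ^+ 2 * rho ^+ k).
    by rewrite !mulrA.
  by rewrite e; ring.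
rewrite -mulr_sumr mulrAC ler_wpM2r ?exprn_ge0 // ler_wpM2l ?mulr_ge0 //.
by apply: binomial_series_bound; rewrite r0.
Unshelve. all: by end_near.
Qed.

End PowerSeries.

(** * Convergence over the complex numbers through real and imaginary parts *)

Section ComplexLimits.
Variable R : realType.
Local Notation C := (R[i]).
Local Notation Re := (@complex.Re R).
Local Notation Im := (@complex.Im R).
Implicit Types (x y z : C).

Lemma Re_add x y : Re (x + y) = Re x + Re y. Proof. by case: x; case: y. Qed.
Lemma Im_add x y : Im (x + y) = Im x + Im y. Proof. by case: x; case: y. Qed.
Lemma Re_opp x : Re (- x) = - Re x. Proof. by case: x. Qed.
Lemma Im_opp x : Im (- x) = - Im x. Proof. by case: x. Qed.
Lemma Re_mul x y : Re (x * y) = Re x * Re y - Im x * Im y.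
Proof. by case: x; case: y. Qed.
Lemma Im_mul x y : Im (x * y) = Re x * Im y + Im x * Re y.
Proof. by case: x; case: y. Qed.

Lemma Re_le x y : x <= y -> Re x <= Re y.
Proof. by rewrite lecE => /andP[]. Qed.

Lemma Re_normC x : (Re `|x|)%:C = `|x|.
Proof. by rewrite RRe_real // normr_real. Qed.

Lemma normr_Re_le x : `|Re x| <= Re `|x|.
Proof. by rewrite -lecR Re_normC normc_ge_Re. Qed.

Lemma normr_Im_le x : `|Im x| <= Re `|x|.
Proof.
have -> : `|x| = `|x * 'i%C| by rewrite normrM complexiE normCi mulr1.
by apply: le_trans (normr_Re_le _); rewrite ReiNIm normrN.
Qed.

Lemma normc_le_ReIm x : `|x| <= (`|Re x| + `|Im x|)%:C.
Proof.
rewrite {1}[x]complexE rmorphD; apply: le_trans (ler_normD _ _) _.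
rewrite normrM complexiE normCi mul1r lerD //;
by rewrite normc_def /= expr0n addr0 sqrtr_sqr.
Qed.

Lemma normc_real (a : R) : `|a%:C| = `|a|%:C.
Proof. by rewrite normc_def /= expr0n addr0 sqrtr_sqr. Qed.

Lemma complex_cvg T (F : set_system T) {FF : Filter F} (u : T -> C) (l : C) :
  Re (u x) @[x --> F] --> Re l -> Im (u x) @[x --> F] --> Im l ->
  (u x : C^o) @[x --> F] --> (l : C^o).
Proof.
move=> /cvgrPdist_le hr /cvgrPdist_le hi; apply/cvgrPdist_le => e e0.
have [er e'0] : e = (Re e)%:C /\ 0 < Re e.
  by case: e e0 => er ei; rewrite ltcE /= => /andP[/eqP-> ->].
have e2 : 0 < Re e / 2 by rewrite divr_gt0.
have {}hr := hr _ e2; have {}hi := hi _ e2; near=> x.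
apply: le_trans (normc_le_ReIm _) _; rewrite er lecR.
rewrite [Re e]splitr Re_add Im_add Re_opp Im_opp.
by apply: lerD; near: x.
Unshelve. all: by end_near.
Qed.

Lemma real_cvg T (F : set_system T) {FF : Filter F} (u : T -> R) (l : R) :
  u @ F --> l -> ((u x)%:C : C^o) @[x --> F] --> (l%:C : C^o).
Proof. by move=> ul; apply: complex_cvg => //=; exact: cvg_cst. Qed.

(** Completeness enters here, over the reals: the real and imaginary parts are dominated by |u k|,
    whose partial sums are bounded, so each of the two real series converges absolutely. *)
Lemma abs_series_cvg (u : nat -> C) (B : C) :
  (forall n, \sum_(k < n) `|u k| <= B) -> exists l : C, series u @ \oo --> (l : C^o).
Proof.
move=> uB.
have h (f : C -> R) (v : nat -> R) : (forall n, v n = f (u n)) ->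
    (forall x, `|f x| <= Re `|x|) -> cvgn (series v).
  move=> vE fx; apply: normed_cvg; apply: nondecreasing_is_cvgn.
    apply/nondecreasing_seqP => n; rewrite /= /series /= big_nat_recr //=.
    by rewrite lerDl.
  exists (Re B) => _ [n _ <-]; apply: le_trans (Re_le (uB n)); rewrite /=.
  rewrite /series /= big_mkord.
  rewrite (big_morph Re (id1 := 0) (op1 := +%R)) //; last exact: Re_add.
  by apply: ler_sum => k _; rewrite vE.
have /cvg_ex[/= a ha] := h Re _ (fun=> erefl) normr_Re_le.
have /cvg_ex[/= b hb] := h Im _ (fun=> erefl) normr_Im_le.
exists (a +i* b); apply: complex_cvg.
  apply: cvg_trans ha; apply: near_eq_cvg; near=> n; rewrite /series /=.
  by rewrite (big_morph Re (id1 := 0) (op1 := +%R)) //; exact: Re_add.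
apply: cvg_trans hb; apply: near_eq_cvg; near=> n; rewrite /series /=.
by rewrite (big_morph Im (id1 := 0) (op1 := +%R)) //; exact: Im_add.
Unshelve. all: by end_near.
Qed.

Lemma psum_ex (a : nat -> C) (M : C) (z : C) :
  (forall n, `|a n| <= M * n.+1%:R) -> `|z| < 1 -> exists s, psum a z s.
Proof.
move=> aM z1; have M0 : 0 <= M.
  by have := le_trans (normr_ge0 _) (aM 0%N); rewrite mulr1.
have := @abs_series_cvg (fun k => a k * z ^+ k) (M * (1 - `|z|) ^- 2).
case=> [n|s hs]; last by exists s.
apply: (@le_trans _ _ (\sum_(k < n) M * ('C(k + 1, 1)%:R * `|z| ^+ k))).
  by apply: ler_sum => k _; rewrite normrM normrX mulrA bin1 addn1 ler_wpM2r ?exprn_ge0.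
by rewrite -mulr_sumr ler_wpM2l // binomial_series_bound // normr_ge0.
Qed.

End ComplexLimits.

(** * Derivatives of complex-valued functions *)

Section ComplexDerivatives.
Variable R : realType.
Local Notation C := (R[i]).
Local Notation Re := (@complex.Re R).
Local Notation Im := (@complex.Im R).
Implicit Types (f g : R -> C) (c l : C) (t : R).

Lemma cderive_eq f t l l' : cderive f t l -> l = l' -> cderive f t l'.
Proof. by move=> + <-. Qed.

Lemma cderive_cst c t : cderive (fun=> c) t 0.
Proof. by split; exact: is_derive_cst. Qed.

Lemma cderiveD f g t l m :
  cderive f t l -> cderive g t m -> cderive (fun u => f u + g u) t (l + m).
Proof.
move=> [fr fi] [gr gi]; split; rewrite ?Re_add ?Im_add.
  by under eq_fun do rewrite Re_add; exact: is_deriveD.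
by under eq_fun do rewrite Im_add; exact: is_deriveD.
Qed.

Lemma cderiveM f g t l m : cderive f t l -> cderive g t m ->
  cderive (fun u => f u * g u) t (l * g t + f t * m).
Proof.
move=> [fr fi] [gr gi]; split; rewrite ?Re_add ?Im_add ?Re_mul ?Im_mul.
  under eq_fun do rewrite Re_mul.
  apply: is_derive_eq; rewrite /GRing.scale /=.
  by ring.
under eq_fun do rewrite Im_mul.
apply: is_derive_eq; rewrite /GRing.scale /=.
by ring.
Qed.

Lemma cderiveZ c f t l : cderive f t l -> cderive (fun u => c * f u) t (c * l).
Proof.
by move=> df; apply: cderive_eq (cderiveM (cderive_cst c t) df) _; rewrite mul0r add0r.
Qed.

Lemma cderiveB f g t l m :
  cderive f t l -> cderive g t m -> cderive (fun u => f u - g u) t (l - m).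
Proof.
move=> df dg; have := cderiveD df (cderiveZ (-1) dg).
by under eq_fun do rewrite mulN1r; rewrite mulN1r.
Qed.

Lemma cderive_sum (I : Type) (r : seq I) (P : pred I) (f : I -> R -> C) t (l : I -> C) :
  (forall i, P i -> cderive (f i) t (l i)) ->
  cderive (fun u => \sum_(i <- r | P i) f i u) t (\sum_(i <- r | P i) l i).
Proof.
move=> df; elim: r => [|i r IH].
  by rewrite big_nil; under eq_fun do rewrite big_nil; exact: cderive_cst.
rewrite big_cons; under eq_fun do rewrite big_cons.
by case: ifP => // Pi; apply: cderiveD => //; exact: df.
Qed.

Lemma cderive_real (f : R -> R) t (l : R) :
  is_derive t 1 f l -> cderive (fun u => (f u)%:C) t l%:C.
Proof. by move=> df; split => //=; exact: is_derive_cst. Qed.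

Lemma cderive_onem f t l : cderive f (1 - t) l -> cderive (fun u => f (1 - u)) t (- l).
Proof.
have h : is_derive t 1 (fun u : R => 1 - u) (-1).
  by rewrite -[fun u => _]/(cst 1 - id); apply: is_derive_eq; rewrite sub0r.
move=> [fr fi]; split; rewrite ?Re_opp ?Im_opp -mulrN1.
  exact: (@is_derive1_comp _ (fun u => Re (f u)) (fun u => 1 - u)).
exact: (@is_derive1_comp _ (fun u => Im (f u)) (fun u => 1 - u)).
Qed.

Lemma is_derive0_cst01 (f : R -> R) :
  (forall t, 0 < t < 1 -> is_derive t 1 f 0) ->
  forall x y, 0 < x < 1 -> 0 < y < 1 -> f x = f y.
Proof.
move=> df x y; wlog xy : x y / x <= y.
  by move=> wl hx hy; case: (leP x y) => [|/ltW] h; [|symmetry]; exact: wl.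
move=> /andP[x0 x1] /andP[y0 y1].
have hd t : t \in `[x, y] -> is_derive t 1 f 0.
  rewrite in_itv /= => /andP[xt ty]; apply: df.
  by rewrite (lt_le_trans x0 xt) (le_lt_trans ty y1).
have hd' t : t \in `]x, y[ -> is_derive t 1 f ((fun=> 0) t).
  by move=> tI; apply: hd; move: tI; rewrite !in_itv /= => /andP[/ltW-> /ltW->].
have hc : {within `[x, y], continuous f}.
  by apply: derivable_within_continuous => t /hd dt; exact: ex_derive.
have [c _] := MVT_segment xy hd' hc.
by rewrite mul0r => /eqP; rewrite subr_eq0 => /eqP.
Qed.

Lemma cderive0_cst01 f : (forall t, 0 < t < 1 -> cderive f t 0) ->
  forall x y, 0 < x < 1 -> 0 < y < 1 -> f x = f y.
Proof.
move=> df x y hx hy; have hr t (ht : 0 < t < 1) := (df t ht).1.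
have hi t (ht : 0 < t < 1) := (df t ht).2.
apply/eqP; rewrite eq_complex; apply/andP; split; apply/eqP.
  exact: is_derive0_cst01 hr x y hx hy.
exact: is_derive0_cst01 hi x y hx hy.
Qed.

(** The complex estimate is restricted to real increments; the real and imaginary parts of the
    remainder are bounded by its modulus. The positive complex number [d] is real, and [K] may be
    replaced by its real part. *)
Lemma cderive_remainder (h : C -> C) t l (K d : C) : 0 < d ->
  (forall k, `|k| < d -> `|h (t%:C + k) - h t%:C - k * l| <= K * `|k| ^+ 2) ->
  cderive (fun u => h u%:C) t l.
Proof.
move=> d0 hK.
have [dr d'0] : d = (Re d)%:C /\ 0 < Re d.
  by case: d d0 {hK} => dr di; rewrite ltcE /= => /andP[/eqP-> ->].
have hR k : `|k| < Re d -> Re `|h (t + k)%:C - h t%:C - k%:C * l| <= Re K * `|k| ^+ 2.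
  move=> kd; have /hK : `|k%:C| < d by rewrite dr normc_real ltcR.
  rewrite -rmorphD /= normc_real -rmorphXn /= => /Re_le; rewrite Re_mul /= mulr0 subr0.
  exact.
split; apply: (@quad_remainder_is_derive _ _ _ _ (Re K) (Re d)) => // k /hR;
    apply: le_trans.
  apply: le_trans (normr_Re_le _); rewrite !Re_add !Re_opp Re_mul /= mul0r subr0 //.
apply: le_trans (normr_Im_le _); rewrite !Im_add !Im_opp Im_mul /= mul0r addr0 //.
Qed.

End ComplexDerivatives.

(** * Functions negligible against all powers of the logarithm *)

Lemma field_cvg_unique (F : numFieldType) T (G : set_system T) {FG : ProperFilter G}
  (u : T -> F) (a b : F) : u x @[x --> G] --> a -> u x @[x --> G] --> b -> a = b.
Proof. by move=> ua ub; apply: cvg_unique ua ub; exact: norm_hausdorff. Qed.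

Section SmallFunctions.
Variable R : realType.
Local Notation C := (R[i]).
Implicit Types (f g : R -> C) (c : C).

(** With x = -ln e, the inequality x^(m+1) <= (m+1)! exp(x) gives e |ln e|^m <= (m+1)! / x, and x
    tends to infinity. *)
Lemma mulr_lnX_cvg0 m : (e * ln e ^+ m : R) @[e --> 0^'+] --> (0 : R).
Proof.
apply/cvgrPdist_le => d d0; near=> e.
have e0 : 0 < e by near: e; exact: nbhs_right_gt.
pose x := - ln e.
have xd : m.+1`!%:R / d <= x.
  rewrite lerNr; near: e.
  have /cvgrNyPle := @lnNy R; exact.
have x0 : 0 < x by apply: lt_le_trans xd; rewrite divr_gt0 // ltr0n fact_gt0.
have eE : e = (expR x)^-1 by rewrite -expRN opprK lnK.
have fx : x ^+ m.+1 <= m.+1`!%:R * expR x.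
  have f0 : (0 : R) < m.+1`!%:R by rewrite ltr0n fact_gt0.
  rewrite mulrC -ler_pdivrMr //; apply: (le_trans _ (expR_ge1Dxn m (ltW x0))).
  by rewrite lerDr.
rewrite sub0r normrN normrM (gtr0_norm e0) normrX -normrN -/x (gtr0_norm x0).
rewrite -(ler_pM2r x0) -mulrA -exprSr; apply: (@le_trans _ _ m.+1`!%:R).
  by rewrite eE mulrC ler_pdivrMr // expR_gt0.
by rewrite mulrC -ler_pdivrMr.
Unshelve. all: by end_near.
Qed.

(* Being o(1) is not preserved by multiplication by log e, whence the
   quantification over m. *)
Definition small f := forall m,
  (f e * (ln e)%:C ^+ m : C^o) @[e --> 0^'+] --> (0 : C^o).

Lemma small_near f g : (\forall e \near 0^'+, f e = g e) -> small f -> small g.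
Proof.
move=> fg hf m; apply: cvg_trans (hf m); apply: near_eq_cvg.
by near=> e; congr (_ * _); near: e.
Unshelve. all: by end_near.
Qed.

Lemma small_ext f g : f =1 g -> small f -> small g.
Proof. by move=> fg; apply: small_near; apply: nearW. Qed.

Lemma small0 : small (fun=> 0).
Proof. by move=> m; under eq_fun do rewrite mul0r; exact: cvg_cst. Qed.

Lemma smallD f g : small f -> small g -> small (fun e => f e + g e).
Proof.
move=> hf hg m; under eq_fun do rewrite mulrDl.
by rewrite -[0 : C^o]addr0; apply: cvgD; [exact: hf|exact: hg].
Qed.

Lemma smallZ c f : small f -> small (fun e => c * f e).
Proof.
move=> hf m; under eq_fun do rewrite -mulrA.
by have := @cvgMl_tmp C _ _ _ _ c _ (hf m); rewrite mulr0; apply.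
Qed.

Lemma smallN f : small f -> small (fun e => - f e).
Proof. by move=> /(smallZ (-1)); apply: small_ext => e; rewrite mulN1r. Qed.

Lemma smallB f g : small f -> small g -> small (fun e => f e - g e).
Proof. by move=> hf hg; apply: smallD => //; exact: smallN. Qed.

Lemma small_sum (I : Type) (r : seq I) (P : pred I) (f : I -> R -> C) :
  (forall i, P i -> small (f i)) -> small (fun e => \sum_(i <- r | P i) f i e).
Proof.
move=> hf; elim: r => [|i r IH].
  by apply: small_ext small0 => e; rewrite big_nil.
case Pi: (P i); last by apply: small_ext IH => e; rewrite big_cons Pi.
by apply: small_ext (smallD (hf i Pi) IH) => e; rewrite big_cons Pi.
Qed.

Lemma small_lnX f k : small f -> small (fun e => f e * (ln e)%:C ^+ k).
Proof. by move=> hf m; under eq_fun do rewrite -mulrA -exprD; exact: hf. Qed.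

Lemma small_lnNX f k : small f -> small (fun e => f e * (- ln e)%:C ^+ k).
Proof.
move=> hf; apply: small_ext (smallZ ((-1) ^+ k) (small_lnX k hf)) => e.
by rewrite mulrCA -exprMn mulN1r rmorphN.
Qed.

Lemma small_cvg f : small f -> (f e : C^o) @[e --> 0^'+] --> (0 : C^o).
Proof. by move=> /(_ 0%N); under eq_fun do rewrite mulr1. Qed.

Lemma small_cvg_to f c :
  small (fun e => f e - c) -> (f e : C^o) @[e --> 0^'+] --> (c : C^o).
Proof.
move=> /small_cvg h.
suff : (f e - c + c : C^o) @[e --> 0^'+] --> (0 + c : C^o).
  by rewrite add0r; under eq_fun do rewrite subrK.
by apply: cvgD; [exact: h|exact: cvg_cst].
Qed.

Lemma small_cst_eq0 c : small (fun=> c) -> c = 0.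
Proof.
by move=> /small_cvg; apply: (@field_cvg_unique C); exact: cvg_cst.
Qed.

Lemma small_O f (K : C) : (\forall e \near 0^'+, `|f e| <= K * e%:C) -> small f.
Proof.
move=> fK m; apply/cvgr0Pnorm_le => d d0.
have hm : ((e * ln e ^+ m)%:C : C^o) @[e --> (0 : R)^'+] --> (0 : C^o).
  by have := real_cvg (@mulr_lnX_cvg0 m); apply.
have K0 : 0 < `|K| + 1 by rewrite ltr_pwDr.
have /cvgr0Pnorm_le/(_ (d / (`|K| + 1))) := hm.
rewrite divr_gt0 // => /(_ isT) hd; near=> e.
have e0 : 0 < e by near: e; exact: nbhs_right_gt.
rewrite normrM.
have : `|(e * ln e ^+ m)%:C| <= d / (`|K| + 1) by near: e.
rewrite ler_pdivlMr // mulrC; apply: le_trans.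
rewrite rmorphM normrM mulrA rmorphXn ler_wpM2r //.
have : `|f e| <= K * e%:C by near: e.
move=> h; apply: (le_trans h); rewrite (_ : `|e%:C| = e%:C); last first.
  by rewrite normc_real gtr0_norm.
rewrite ler_wpM2r ?lecR ?(ltW e0) //.
have K1 : 0 <= K.
  by have := le_trans (normr_ge0 _) h; rewrite pmulr_lge0 // ltcR.
by rewrite (ger0_norm K1) lerDl.
Unshelve. all: by end_near.
Qed.

End SmallFunctions.

(** * Holomorphic functions on a disc and their behaviour at the centre *)

Section Holomorphic.
Variable R : realType.
Local Notation C := (R[i]).
Implicit Types (r : R) (f g : C -> C) (c : C).

Lemma holomorphic_cst r c : holomorphic_on_disc r (fun=> c).
Proof. by move=> z _; exact: derivable_cst. Qed.

Lemma holomorphicD r f g : holomorphic_on_disc r f -> holomorphic_on_disc r g ->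
  holomorphic_on_disc r (fun z => f z + g z).
Proof. by move=> hf hg z zr; apply: derivableD; [exact: hf|exact: hg]. Qed.

Lemma holomorphicM r f g : holomorphic_on_disc r f -> holomorphic_on_disc r g ->
  holomorphic_on_disc r (fun z => f z * g z).
Proof. by move=> hf hg z zr; apply: derivableM; [exact: hf|exact: hg]. Qed.

Lemma holomorphic_sum r (I : Type) (s : seq I) (P : pred I) (f : I -> C -> C) :
  (forall i, P i -> holomorphic_on_disc r (f i)) ->
  holomorphic_on_disc r (fun z => \sum_(i <- s | P i) f i z).
Proof.
move=> hf; elim: s => [|i s IH].
  rewrite (_ : (fun z => _) = fun=> 0); first exact: holomorphic_cst.
  by apply/funext => z; rewrite big_nil.
case Pi: (P i).
  rewrite (_ : (fun z => _) = fun z => f i z + \sum_(j <- s | P j) f j z); last first.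
    by apply/funext => z; rewrite big_cons Pi.
  exact: (holomorphicD (hf i Pi) IH).
rewrite (_ : (fun z => _) = fun z => \sum_(j <- s | P j) f j z); first exact: IH.
by apply/funext => z; rewrite big_cons Pi.
Qed.

Lemma holomorphic_on_discW r s f : s <= r ->
  holomorphic_on_disc r f -> holomorphic_on_disc s f.
Proof. by move=> sr hf z zs; apply: hf; apply: lt_le_trans zs _; rewrite lecR. Qed.

(** Differentiability at 0 alone gives f(e) - f(0) = O(e), with constant |f'(0)| + 1, and O(e) beats
    every power of log e. *)
Lemma small_holomorphic r f : 0 < r -> holomorphic_on_disc r f ->
  small (fun e => f e%:C - f 0).
Proof.
move=> r0 hf; have /cvg_ex[/= l hl] : derivable (f : C^o -> C^o) 0 1.
  by apply: hf; rewrite normr0 ltcR.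
have /cvgrPdist_le/(_ 1 ltr01) := hl => /nbhs_ballP [d /= d0 hd].
have [dr d'0] : d = (complex.Re d)%:C /\ 0 < complex.Re d.
  by case: d d0 {hd} => dr di; rewrite ltcE /= => /andP[/eqP-> ->].
apply: (@small_O _ _ (`|l| + 1)); near=> e.
have e0 : 0 < e by near: e; exact: nbhs_right_gt.
have ec0 : e%:C != 0 :> C by rewrite eq_complex /= gt_eqF.
have /hd/(_ ec0) : ball (0 : C^o) d e%:C.
  rewrite -ball_normE /= sub0r normrN normc_real gtr0_norm // dr ltcR.
  by near: e; exact: nbhs_right_lt.
rewrite addr0 [_ *: 1]mulr1 => h.
have -> : f e%:C - f 0 = e%:C * (e%:C^-1 *: (f e%:C - f 0)).
  by rewrite -[_ *: _]/(_ * _) mulVKf.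
rewrite normrM mulrC normc_real (gtr0_norm e0) ler_wpM2r ?lecR ?(ltW e0) //.
set q := _ *: _ in h *; have -> : q = l - (l - q) by rewrite subKr.
by apply: le_trans (ler_normB _ _) _; rewrite lerD2l.
Unshelve. all: by end_near.
Qed.

End Holomorphic.

(** * Local solutions of the KZ equation *)

Section PowerSeriesSums.
Variable F : numFieldType.

Lemma psum0 (z : F) : psum (fun=> 0) z 0.
Proof.
rewrite /psum (_ : series _ = cst 0); first exact: cvg_cst.
by apply/funext => n; rewrite /series /= big1 // => k _; rewrite mul0r.
Qed.

Lemma psum_sum (I : Type) (r : seq I) (a : I -> nat -> F) z s :
  (forall i, psum (a i) z (s i)) ->
  psum (fun n => \sum_(i <- r) a i n) z (\sum_(i <- r) s i).
Proof.
move=> ha; elim: r => [|i r IH].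
  rewrite big_nil (_ : (fun n => _) = fun=> 0); first exact: psum0.
  by apply/funext => n; rewrite big_nil.
rewrite big_cons (_ : (fun n => _) = fun n => a i n + \sum_(j <- r) a j n).
  exact: psumD.
by apply/funext => n; rewrite big_cons.
Qed.

Lemma psum_ncmull (S : ncseries F) (T : nat -> ncseries F) (U : ncseries F) z w :
  (forall u, psum (T^~ u) z (U u)) ->
  psum (fun n => ncmul S (T n) w) z (ncmul S U w).
Proof. by move=> h; apply: psum_sum => i; exact: psumZ. Qed.

Lemma psum_ncmulr (S : ncseries F) (T : nat -> ncseries F) (U : ncseries F) z w :
  (forall u, psum (T^~ u) z (U u)) ->
  psum (fun n => ncmul (T n) S w) z (ncmul U S w).
Proof.
move=> h; rewrite /ncmul; under eq_fun do under eq_bigr do rewrite mulrC.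
by under eq_bigr do rewrite mulrC; apply: psum_sum => i; exact: psumZ.
Qed.

End PowerSeriesSums.

Section LocalSolution.
Variables (F : numFieldType) (a : bool).

(* Right-hand side of the recursion n h_n = [A, h_n] - B (h_0 + ... + h_(n-1))
   satisfied by the Taylor coefficients at 0 of the solution H of
   H' = [A, H] / z + B H / (z - 1). *)
Definition kz_coef_rhs (T : nat -> ncseries F) n : ncseries F := fun w =>
  ncmul (ncvar F a) (T n.+1) w - ncmul (T n.+1) (ncvar F a) w
  - ncmul (ncvar F (~~ a)) (fun u => \sum_(j < n.+1) T j u) w.

(* The recursion computes h_n at a word from its values at shorter words, so k
   rounds determine h_n at the words of length at most k. *)
Fixpoint kz_coef_iter k n {struct k} : ncseries F :=
  match n, k with
  | 0, _ => nc1 F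
  | _, 0 => fun=> 0
  | n'.+1, k'.+1 => ncscale n'.+1%:R^-1 (kz_coef_rhs (kz_coef_iter k') n')
  end.

Definition kz_coef n : ncseries F := fun w => kz_coef_iter (size w) n w.

Lemma ncmul_varr_cons S b v :
  ncmul S (ncvar F a) (b :: v) = (last b v == a)%:R * S (belast b v).
Proof. by rewrite lastI ncmul_varr. Qed.

Lemma kz_coef_rhs_nil T n : kz_coef_rhs T n [::] = 0.
Proof. by rewrite /kz_coef_rhs !ncmul_nil /ncvar !mul0r mulr0 !subr0. Qed.

Lemma eq_kz_coef_rhs T T' n w :
  (forall j u, (size u < size w)%N -> T j u = T' j u) ->
  kz_coef_rhs T n w = kz_coef_rhs T' n w.
Proof.
case: w => [|b v] TT'; first by rewrite !kz_coef_rhs_nil.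
rewrite /kz_coef_rhs !ncmul_var !ncmul_varr_cons.
rewrite !TT' ?size_belast //; congr (_ - _ * _).
by apply: eq_bigr => j _; rewrite TT'.
Qed.

Lemma kz_coef_iter_stable k l n w : (size w <= k)%N -> (size w <= l)%N ->
  kz_coef_iter k n w = kz_coef_iter l n w.
Proof.
elim: k l n w => [|k IH] [|l] [|n] w //=; rewrite ?leqn0.
- by move=> /nilP-> _; rewrite /ncscale kz_coef_rhs_nil mulr0.
- by move=> _ /nilP->; rewrite /ncscale kz_coef_rhs_nil mulr0.
move=> wk wl; rewrite /ncscale; congr (_ * _); apply: eq_kz_coef_rhs => j u uw.
by apply: IH; rewrite -ltnS; [exact: leq_trans uw wk|exact: leq_trans uw wl].
Qed.

Lemma kz_coef0 : kz_coef 0 = nc1 F.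
Proof. by apply/funext => w; rewrite /kz_coef; case: (size w). Qed.

Lemma kz_coefS n w : n.+1%:R * kz_coef n.+1 w = kz_coef_rhs kz_coef n w.
Proof.
rewrite /kz_coef (kz_coef_iter_stable _ (leqnn _) (leqnSn _)) /= /ncscale mulVKf ?pnatr_eq0 //.
by apply: eq_kz_coef_rhs => j u uw; apply: kz_coef_iter_stable => //; exact: ltnW.
Qed.

(** The right-hand side of the recursion has three terms, each read at a word one letter shorter and
    each at most (n+1) 3^(|w|-1). For the last one this is a sum of n + 1 coefficients, and the
    factor n + 1 on the left compensates it. *)
Lemma kz_coef_bound n w : `|kz_coef n w| <= 3 ^+ size w.
Proof.
elim: {w}(size w) {-2}w (erefl (size w)) n => [w /size0nil->|k IH w wk] [|n].
- by rewrite kz_coef0 /nc1 normr_nat.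
- have /eqP := kz_coefS n [::]; rewrite kz_coef_rhs_nil mulf_eq0 pnatr_eq0 /= => /eqP->.
  by rewrite normr0 expr0.
- by rewrite kz_coef0 /nc1 normr_nat; case: w {wk} => //= b v; rewrite exprn_ge0.
have n0 : (0 : F) < n.+1%:R by rewrite ltr0n.
rewrite -(ler_pM2l n0) -{1}(gtr0_norm n0) -normrM kz_coefS.
case: w wk => [//|b v] [vk].
have bnd (c : bool) (u : seq bool) (B : F) x : `|x| <= B -> `|c%:R * x| <= B.
  move=> xB; case: c; rewrite ?mul1r // mul0r normr0.
  exact: le_trans xB.
have h1 : `|ncmul (ncvar F a) (kz_coef n.+1) (b :: v)| <= n.+1%:R * 3 ^+ k.
  rewrite ncmul_var; apply: bnd => //; apply: le_trans (IH _ vk _) _.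
  by rewrite vk ler_peMl ?exprn_ge0 // ler1n.
have h2 : `|ncmul (kz_coef n.+1) (ncvar F a) (b :: v)| <= n.+1%:R * 3 ^+ k.
  rewrite ncmul_varr_cons; apply: bnd => //.
  apply: le_trans (IH _ _ _) _; first by rewrite size_belast.
  by rewrite size_belast vk ler_peMl ?exprn_ge0 // ler1n.
have h3 : `|ncmul (ncvar F (~~ a)) (fun u => \sum_(j < n.+1) kz_coef j u) (b :: v)|
    <= n.+1%:R * 3 ^+ k.
  rewrite ncmul_var; apply: bnd => //; apply: le_trans (ler_norm_sum _ _ _) _.
  apply: (@le_trans _ _ (\sum_(j < n.+1) 3 ^+ k)); first last.
    by rewrite sumr_const card_ord mulr_natl.
  by apply: ler_sum => j _; rewrite -vk; exact: IH.
rewrite /kz_coef_rhs [size _]/= vk exprS 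
  (_ : _ * (3 * _) = n.+1%:R * 3 ^+ k + n.+1%:R * 3 ^+ k + n.+1%:R * 3 ^+ k);
  last by ring.
apply: le_trans (ler_normB _ _) (lerD _ h3).
exact: le_trans (ler_normB _ _) (lerD h1 h2).
Qed.

End LocalSolution.

Section LocalSolutionSum.
Variables (R : realType) (a : bool).
Local Notation C := (R[i]).
Local Notation X := (ncvar C a).
Local Notation Y := (ncvar C (~~ a)).

Lemma kz_coef_sum_bound n w : `|\sum_(j < n.+1) kz_coef C a j w| <= 3 ^+ size w * n.+1%:R.
Proof.
apply: le_trans (ler_norm_sum _ _ _) _.
apply: (@le_trans _ _ (\sum_(j < n.+1) 3 ^+ size w)).
  by apply: ler_sum => j _; exact: kz_coef_bound.
by rewrite sumr_const card_ord mulr_natr.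
Qed.

Lemma kz_coef_bound_lin n w : `|kz_coef C a n w| <= 3 ^+ size w * n.+1%:R.
Proof.
apply: le_trans (kz_coef_bound _ _ _ _) _.
by rewrite ler_peMr ?exprn_ge0 // ler1n.
Qed.

(** The equation is multiplied by z (1 - z) so that it also makes sense at z = 0. Shifting the
    coefficients sums to H1 = (H - 1)/z and taking their partial sums gives S = H/(1 - z); the
    recursion then reads H' = [X, H1] - Y S, and [X, H] = z [X, H1] because 1 commutes with X. *)
Lemma local_solution_remainder : exists H : C -> ncseries C, H 0 = nc1 C /\
  forall z w, `|z| < 1 -> exists l : C,
    (1 - z) * (z * l) = (1 - z) * (ncmul X (H z) w - ncmul (H z) X w)
                        - z * ncmul Y (H z) w /\
    exists d, exists2 K, 0 < d &
      forall h, `|h| < d -> `|H (z + h) w - H z w - h * l| <= K * `|h| ^+ 2.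
Proof.
(* Sums are chosen for all points and words at once; outside the unit disc the value 0 is a
   placeholder. *)
have /choice[H hH] : forall p : C * seq bool, exists s,
    `|p.1| < 1 -> psum (fun n => kz_coef C a n p.2) p.1 s.
  move=> [z w] /=; have [z1|] := boolP (`|z| < 1); last by exists 0.
  have [s hs] := psum_ex (fun n => kz_coef_bound_lin n w) z1; by exists s.
have /choice[H1 hH1] : forall p : C * seq bool, exists s,
    `|p.1| < 1 -> psum (fun n => kz_coef C a n.+1 p.2) p.1 s.
  move=> [z w] /=; have [z1|] := boolP (`|z| < 1); last by exists 0.
  have hb n : `|kz_coef C a n.+1 w| <= 3 ^+ size w * n.+1%:R.
    by apply: le_trans (kz_coef_bound _ _ _ _) _; rewrite ler_peMr ?exprn_ge0 // ler1n.
  have [s hs] := psum_ex hb z1; by exists s.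
have /choice[S hS] : forall p : C * seq bool, exists s,
    `|p.1| < 1 -> psum (fun n => \sum_(j < n.+1) kz_coef C a j p.2) p.1 s.
  move=> [z w] /=; have [z1|] := boolP (`|z| < 1); last by exists 0.
  have [s hs] := psum_ex (fun n => kz_coef_sum_bound n w) z1; by exists s.
have HE z w : `|z| < 1 -> H (z, w) = nc1 C w + z * H1 (z, w).
  move=> z1; apply: psum_unique (hH (z, w) z1) _ => /=.
  by have := @psum_recl _ (fun n => kz_coef C a n w) _ _ (hH1 (z, w) z1); rewrite kz_coef0.
have SE z w : `|z| < 1 -> (1 - z) * S (z, w) = H (z, w).
  move=> z1; suff e : S (z, w) = nc1 C w + z * (S (z, w) + H1 (z, w)).
    by rewrite HE // mulrBl mul1r {1}e; ring.
  apply: psum_unique (hS (z, w) z1) _ => /=.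
  have : psum (fun n => \sum_(j < n.+2) kz_coef C a j w) z (S (z, w) + H1 (z, w)).
    rewrite (_ : (fun n => _) =
        fun n => \sum_(j < n.+1) kz_coef C a j w + kz_coef C a n.+1 w).
      exact: (psumD (hS (z, w) z1) (hH1 (z, w) z1)).
    by apply/funext => n; rewrite big_ord_recr.
  move=> /(@psum_recl _ (fun n => \sum_(j < n.+1) kz_coef C a j w)).
  by rewrite big_ord_recl big_ord0 addr0 kz_coef0.
exists (fun z w => H (z, w)); split.
  by apply/funext => w; rewrite HE ?normr0 ?ltr01 // mul0r addr0.
move=> z w z1.
pose G z := ncmul X (fun u => H1 (z, u)) w - ncmul (fun u => H1 (z, u)) X w
  - ncmul Y (fun u => S (z, u)) w.
exists (G z); split; last first.
  apply: (@psum_remainder _ (fun n => kz_coef C a n w) (3 ^+ size w)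
    (fun y => H (y, w)) G z _ _ _ z1) => [n|y y1|y y1].
  - exact: kz_coef_bound_lin.
  - exact: (hH (y, w) y1).
  - under eq_fun do rewrite kz_coefS.
    apply: psumB; last first.
      apply: (psum_ncmull (T := fun n u => \sum_(j < n.+1) kz_coef C a j u)) => u.
      exact: (hS (y, u) y1).
    apply: psumB.
      by apply: psum_ncmull => u; exact: (hH1 (y, u) y1).
    by apply: psum_ncmulr => u; exact: (hH1 (y, u) y1).
have HzE : (fun u => H (z, u)) = ncadd (nc1 C) (ncscale z (fun u => H1 (z, u))).
  by apply/funext => u; rewrite HE.
have -> : ncmul Y (fun u => H (z, u)) w = (1 - z) * ncmul Y (fun u => S (z, u)) w.
  rewrite -[RHS]/(ncscale (1 - z) _ w) -ncmulZr; congr (ncmul _ _ _).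
  by apply/funext => u; rewrite -SE.
rewrite HzE ncmulDr ncmulDl ncmulZr ncmulZl ncmul1l ncmul1r /G /ncadd /ncscale.
by ring.
Qed.

Lemma local_solution : exists H : C -> ncseries C,
  [/\ H 0 = nc1 C, forall w, holomorphic_on_disc 1 (fun z => H z w) &
      forall (t : R) w, 0 < t < 1 -> cderive (fun u => H u%:C w) t
        (t^-1%:C * (ncmul X (H t%:C) w - ncmul (H t%:C) X w)
         + (t - 1)^-1%:C * ncmul Y (H t%:C) w)].
Proof.
have [H [H0 hH]] := local_solution_remainder.
exists H; split => // [w z z1|t w /andP[t0 t1]].
  have [l [_ [d [K d0 hK]]]] := hH z w z1.
  by have [dH _] := @quad_remainder_is_derive C (fun z => H z w) z l K d d0 hK.
have tc1 : `|t%:C| < 1 :> C by rewrite normc_real gtr0_norm // ltcR.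
have [l [lE [d [K d0 hK]]]] := hH t%:C w tc1.
apply: cderive_eq (@cderive_remainder _ (fun z => H z w) t l K d d0 hK) _.
have t0' : t%:C != 0 :> C by rewrite eq_complex /= gt_eqF.
have t1' : 1 - t%:C != 0 :> C.
  by rewrite subr_eq0 eq_sym eq_complex /= eqxx andbT lt_eqF.
apply: (mulfI t0'); apply: (mulfI t1'); rewrite lE.
rewrite !fmorphV rmorphB rmorph1 /=.
field.
by rewrite t0' -opprB oppr_eq0 t1'.
Qed.

End LocalSolutionSum.

(** * The KZ equation: solutions, uniqueness, exchange of the cusps *)

Section KZEquation.
Variable R : realType.
Local Notation C := (R[i]).
Local Notation expvar a c := (ncexp (ncscale c (ncvar C a))).
Implicit Types (S T : R -> ncseries C) (a : bool) (w : seq bool) (t : R).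

Lemma cderiveX (f : R -> C) t l n :
  cderive f t l -> cderive (fun u => f u ^+ n.+1) t (n.+1%:R * f t ^+ n * l).
Proof.
move=> df; elim: n => [|n IH]; first by apply: cderive_eq df _; rewrite expr0 !mul1r.
under eq_fun do rewrite exprS.
by apply: cderive_eq (cderiveM df IH) _; rewrite exprS -[n.+2%:R]natr1; ring.
Qed.

Lemma cderive_ncmul S T t (S' T' : ncseries C) w :
  (forall u, cderive (fun x => S x u) t (S' u)) ->
  (forall u, cderive (fun x => T x u) t (T' u)) ->
  cderive (fun x => ncmul (S x) (T x) w) t
          (ncmul S' (T t) w + ncmul (S t) T' w).
Proof.
move=> dS dT; rewrite /ncmul -big_split.
by apply: cderive_sum => i _; apply: cderiveM.
Qed.

Lemma cderive_expvar_ln a t w : 0 < t ->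
  cderive (fun u => expvar a (ln u)%:C w) t
          (t^-1%:C * ncmul (ncvar C a) (expvar a (ln t)%:C) w).
Proof.
move=> t0; rewrite (_ : (fun u => _) = fun u =>
  (size w)`!%:R^-1 * (all (pred1 a) w)%:R * (ln u)%:C ^+ size w); last first.
  by apply/funext => u; rewrite ncexp_var; ring.
have dln : cderive (fun u : R => (ln u)%:C) t t^-1%:C.
  by apply: cderive_real; exact: is_derive1_ln.
case: w => [|b v].
  rewrite ncmul_nil /ncvar mul0r mulr0.
  exact: (cderive_cst (_ * _ * 1)).
apply: cderive_eq (cderiveZ _ (cderiveX (size v) dln)) _.
rewrite ncmul_var ncexp_var /= factS natrM -mulnb natrM.
have f0 : (size v)`!%:R != 0 :> C by rewrite pnatr_eq0 -lt0n fact_gt0.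
have s0 : 1 + (size v)%:R != 0 :> C by rewrite nat1r pnatr_eq0.
have t0' : t%:C != 0 :> C by rewrite eq_complex /= gt_eqF.
by field; rewrite f0 t0' s0.
Qed.

(** For [a = false] this is [KZ_form]; for [a = true] it is the form in the coordinate s = 1 - z,
    where B has its pole at s = 0. One local construction thus serves both cusps. *)
Definition KZ_local a t : ncseries C :=
  ncadd (ncscale t^-1%:C (ncvar C a)) (ncscale (t - 1)^-1%:C (ncvar C (~~ a))).

Definition KZ_solution S :=
  forall z, 0 < z < 1 -> forall w,
     cderive (fun u => S u w) z (ncmul (KZ_form z) (S z) w).

(** Differentiating the right factor t^X contributes H X / t, which cancels the right half of the
    commutator [X, H] / t and leaves a left multiplication. *)
Lemma KZ_local_solution a : exists H : C -> ncseries C,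
  [/\ H 0 = nc1 C, forall w, holomorphic_on_disc 1 (fun z => H z w) &
      forall t, 0 < t < 1 -> forall w,
        cderive (fun u => ncmul (H u%:C) (expvar a (ln u)%:C) w) t
          (ncmul (KZ_local a t) (ncmul (H t%:C) (expvar a (ln t)%:C)) w)].
Proof.
have [H [H0 Hh dH]] := @local_solution R a.
exists H; split => // t t01 w; have /andP[t0 _] := t01.
apply: cderive_eq (cderive_ncmul (S := fun u => H u%:C) w (fun u => dH t u t01)
  (fun u => cderive_expvar_ln a u t0)) _.
set E := expvar a _; set h := H _; set X := ncvar C a; set Y := ncvar C _.
have -> : (fun u => t^-1%:C * (ncmul X h u - ncmul h X u) + (t - 1)^-1%:C * ncmul Y h u)
    = ncadd (ncscale t^-1%:C (ncadd (ncmul X h) (ncscale (-1) (ncmul h X))))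
            (ncscale (t - 1)^-1%:C (ncmul Y h)).
  by apply/funext => u; rewrite /ncadd /ncscale mulN1r.
rewrite -[fun u => t^-1%:C * ncmul X E u]/(ncscale t^-1%:C (ncmul X E)).
rewrite /KZ_local !(ncmulDl, ncmulZl, ncmulZr) -!ncmulA /ncadd /ncscale.
by ring.
Qed.

(** The derivative of the coefficient at [b :: v] involves only the coefficient at [v]. Once the
    latter vanishes the former is constant, and the hypothesis, which carries the initial value or
    the asymptotics, makes it zero. *)
Lemma KZ_solution_eq0 S : KZ_solution S ->
  (forall w c, (forall t, 0 < t < 1 -> S t w = c) -> c = 0) ->
  forall t, 0 < t < 1 -> S t = fun=> 0.
Proof.
move=> dS S0; suff h w t : 0 < t < 1 -> S t w = 0.
  by move=> t t01; apply/funext => w; exact: h.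
elim: w t => [|b v IH] t t01.
  have cS : forall u, 0 < u < 1 -> cderive (fun u => S u [::]) u 0.
    move=> u u01; apply: cderive_eq (dS u u01 [::]) _.
    by rewrite ncmul_nil /KZ_form /ncadd /ncscale /ncvar !mulr0 addr0 mul0r.
  apply: (S0 [::]) => u u01; exact: cderive0_cst01 cS _ _ u01 t01.
have cS : forall u, 0 < u < 1 -> cderive (fun u => S u (b :: v)) u 0.
  move=> u u01; apply: cderive_eq (dS u u01 (b :: v)) _.
  rewrite /KZ_form ncmulDl !ncmulZl /ncadd /ncscale !ncmul_var IH //.
  by rewrite !mulr0 addr0.
apply: (S0 (b :: v)) => u u01; exact: cderive0_cst01 cS _ _ u01 t01.
Qed.

Lemma KZ_solutionB S T : KZ_solution S -> KZ_solution T ->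
  KZ_solution (fun t w => S t w - T t w).
Proof.
move=> dS dT z z01 w; apply: cderive_eq (cderiveB (dS z z01 w) (dT z z01 w)) _.
by rewrite /ncmul -sumrB; apply: eq_bigr => i _; rewrite mulrBr.
Qed.

Lemma KZ_solution_mulr S (U : ncseries C) : KZ_solution S ->
  KZ_solution (fun t => ncmul (S t) U).
Proof.
move=> dS z z01 w; rewrite ncmulA.
apply: cderive_eq (cderive_ncmul (T := fun=> U) (T' := fun=> 0) w (dS z z01) _) _.
  by move=> u; exact: cderive_cst.
by rewrite [X in _ + X]big1 ?addr0 // => i _; rewrite mulr0.
Qed.

Lemma KZ_local_onem S :
  (forall t, 0 < t < 1 -> forall w,
    cderive (fun u => S u w) t (ncmul (KZ_local true t) (S t) w)) ->
  KZ_solution (fun t => S (1 - t)).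
Proof.
move=> dS z z01 w.
have z01' : 0 < 1 - z < 1 by move: z01 => /andP[z0 z1]; rewrite subr_gt0 z1 gtrBl.
apply: cderive_eq (cderive_onem (dS _ z01' w)) _.
rewrite /KZ_form /KZ_local !ncmulDl !ncmulZl /ncadd /ncscale /=.
have -> : 1 - z - 1 = - z by ring.
have -> : 1 - z = - (z - 1) by ring.
by rewrite !invrN !rmorphN /=; ring.
Qed.

(** Each coefficient of the exponential is a fixed multiple of a power of -log e, which smallness
    absorbs. *)
Lemma small_expvar_mull a S w : (forall u, small (fun e => S e u)) ->
  small (fun e => ncmul (expvar a (- ln e)%:C) (S e) w).
Proof.
move=> hS; apply: small_sum => i _.
set k := size (take i w).
apply: small_ext (smallZ ((k`!%:R)^-1 * (all (pred1 a) (take i w))%:R)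
  (small_lnNX k (hS (drop i w)))) => e.
by rewrite ncexp_var -/k; ring.
Qed.

Lemma small_expvar_mulr a S w : (forall u, small (fun e => S e u)) ->
  small (fun e => ncmul (S e) (expvar a (ln e)%:C) w).
Proof.
move=> hS; apply: small_sum => i _.
set k := size (drop i w).
apply: small_ext (smallZ ((k`!%:R)^-1 * (all (pred1 a) (drop i w))%:R)
  (small_lnX k (hS (take i w)))) => e.
by rewrite ncexp_var -/k; ring.
Qed.

Lemma small_mulr S (U : ncseries C) w : (forall u, small (fun e => S e u)) ->
  small (fun e => ncmul (S e) U w).
Proof.
move=> hS; apply: small_sum => i _.
by apply: small_ext (smallZ (U (drop i w)) (hS (take i w))) => e; rewrite mulrC.
Qed.

End KZEquation.

(** * The connection series and its identification with the associator *)

Section Associator.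
Variable R : realType.
Local Notation C := (R[i]).
Local Notation expvar a c := (ncexp (ncscale c (ncvar C a))).
Implicit Types (H : C -> ncseries C) (Phi : ncseries C) (a : bool).

Definition local_sol H a (s : R) : ncseries C := ncmul (H s%:C) (expvar a (ln s)%:C).

Lemma ncexp_nil c a : expvar a c [::] = 1.
Proof. by rewrite ncexp_var expr0 fact0 divr1 mulr1. Qed.

Lemma expvarNK c a : ncmul (expvar a c) (expvar a (- c)) = nc1 C.
Proof. by rewrite ncexp_varD subrr ncexp_var0. Qed.

Lemma expvarKN c a : ncmul (expvar a (- c)) (expvar a c) = nc1 C.
Proof. by rewrite ncexp_varD addNr ncexp_var0. Qed.

Lemma small_sub1 H r w : 0 < r -> H 0 = nc1 C ->
  (forall w, holomorphic_on_disc r (fun z => H z w)) ->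
  small (fun e => H e%:C w - nc1 C w).
Proof. by move=> r0 H0 Hh; rewrite -H0; exact: small_holomorphic (Hh w). Qed.

Lemma small_cst_near01 f (c : C) : small f ->
  (forall t : R, 0 < t < 1 -> f t = c) -> c = 0.
Proof.
move=> sf fc; apply: small_cst_eq0; apply: small_near sf; near=> e.
apply: fc; apply/andP; split; near: e; first exact: nbhs_right_gt.
by apply: nbhs_right_lt.
Unshelve. all: by end_near.
Qed.

Lemma connection_series : exists (H : bool -> C -> ncseries C) Phi,
  [/\ forall a, H a 0 = nc1 C,
      forall a w, holomorphic_on_disc 1 (fun z => H a z w),
      KZ_solution (local_sol (H false) false) /\
      KZ_solution (fun t => local_sol (H true) true (1 - t)),
      forall t, 0 < t < 1 -> local_sol (H false) false t =
        ncmul (local_sol (H true) true (1 - t)) Phi &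
      Phi [::] = 1].
Proof.
have /choice[H hH] := @KZ_local_solution R.
have H0 a : H a 0 = nc1 C by case: (hH a).
have Hh a w : holomorphic_on_disc 1 (fun z => H a z w) by case: (hH a).
have KZ0 : KZ_solution (local_sol (H false) false).
  by move=> t t01 w; have [_ _ /(_ t t01 w)] := hH false.
have KZ1 : KZ_solution (fun t => local_sol (H true) true (1 - t)).
  by apply: KZ_local_onem => t t01 w; have [_ _ /(_ t t01 w)] := hH true.
(* The constant term of a local solution has zero derivative and tends to that of H(0) = 1. It makes
   the solution invertible as a series and gives the constant term of Phi. *)
have Gnil a t : 0 < t < 1 -> local_sol (H a) a t [::] = 1.
  move=> t01; have [_ _ dG] := hH a.
  have cG : forall u, 0 < u < 1 -> cderive (fun u => local_sol (H a) a u [::]) u 0.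
    move=> u u01; apply: cderive_eq (dG u u01 [::]) _.
    by rewrite ncmul_nil /KZ_local /ncadd /ncscale /ncvar !mulr0 addr0 mul0r.
  have h := small_sub1 [::] ltr01 (H0 a) (Hh a).
  apply/eqP; rewrite -subr_eq0; apply/eqP; apply: (small_cst_near01 h) => u u01.
  rewrite (cderive0_cst01 cG t01 u01) /local_sol ncmul_nil ncexp_nil mulr1.
  by [].
have t12 : 0 < (2^-1 : R) < 1 by apply/andP; split; lra.
have t12' : 0 < (1 - 2^-1 : R) < 1.
  by move: t12 => /andP[? ?]; rewrite subr_gt0 gtrBl; apply/andP.
(* Phi is defined at one arbitrary interior point. There G_0 - G_1 Phi vanishes, so any coefficient
   of it that is constant is zero, which is the hypothesis of [KZ_solution_eq0]. *)
have [Phi PhiE] := @ncsolve _ (local_sol (H true) true (1 - 2^-1))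
  (local_sol (H false) false (2^-1)) (Gnil true _ t12').
exists H, Phi; split => //.
  move=> t t01.
  have := KZ_solution_eq0 (KZ_solutionB KZ0 (KZ_solution_mulr Phi KZ1)).
  move=> /(_ _ t t01) h; apply/funext => w; apply/eqP; rewrite -subr_eq0; apply/eqP.
  have {}h := congr1 (fun S => S w) (h _); apply: h => u c hc.
  by rewrite -(hc _ t12) PhiE subrr.
have := congr1 (fun S => S [::]) PhiE.
by rewrite /= ncmul_nil !Gnil // mul1r.
Qed.

(** Near 0 the difference is (H - H') e^A, where both H and H' tend to 1; it stays small after
    multiplication by e^A, and a small constant is zero. *)
Lemma is_G0_unique G G' : @is_G0 R G -> is_G0 G' -> forall t, 0 < t < 1 -> G t = G' t.
Proof.
have GE (S : R -> ncseries C) H r : (forall z, 0 < z < 1 -> z < r ->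
      ncmul (S z) (ncexp (ncscale (- ln z)%:C (ncA C))) = H z%:C) ->
    forall z, 0 < z < 1 -> z < r -> S z = ncmul (H z%:C) (expvar false (ln z)%:C).
  move=> h z z01 zr; rewrite -h // rmorphN -ncmulA expvarKN ncmul1r.
  by [].
move=> [dG [r [H [r0 Hh H0 /GE GH]]]] [dG' [r' [H' [r0' Hh' H0' /GE GH']]]] t t01.
apply/funext => w; apply/eqP; rewrite -subr_eq0; apply/eqP.
suff h : (fun w => G t w - G' t w) = fun=> 0 by have := congr1 (fun S => S w) h.
apply: (KZ_solution_eq0 (KZ_solutionB dG dG') _ t01) => {t t01} {}w c hc.
apply: small_cst_eq0.
have sH u : small (fun e => H e%:C u - H' e%:C u).
  apply: small_ext (smallB (small_sub1 u r0 H0 Hh) (small_sub1 u r0' H0' Hh')) => e.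
  by rewrite opprB addrA subrK.
apply: small_near (small_expvar_mulr false w sH); near=> e.
have e01 : 0 < e < 1.
  apply/andP; split; near: e; first exact: nbhs_right_gt.
  by apply: nbhs_right_lt.
have er : e < r by near: e; exact: nbhs_right_lt.
have er' : e < r' by near: e; exact: nbhs_right_lt.
rewrite -(hc e e01) (GH _ e01 er) (GH' _ e01 er').
by rewrite /ncmul -sumrB; apply: eq_bigr => i _; rewrite mulrBl.
Unshelve. all: by end_near.
Qed.

Lemma connection_series_PhiKZ (H : bool -> C -> ncseries C) Phi :
  (forall a, H a 0 = nc1 C) ->
  (forall a w, holomorphic_on_disc 1 (fun z => H a z w)) ->
  KZ_solution (local_sol (H false) false) ->
  (forall t, 0 < t < 1 -> local_sol (H false) false t =
        ncmul (local_sol (H true) true (1 - t)) Phi) ->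
  unique (@is_PhiKZ R) Phi.
Proof.
move=> H0 Hh KZ0 G01; set G := local_sol (H false) false.
have hG : is_G0 G.
  split; first exact: KZ0.
  exists 1, (H false); split => // z z01 _.
  by rewrite /G /local_sol rmorphN -ncmulA expvarNK ncmul1r.
(* Proved for every admissible S, because [is_PhiKZ] lets its solution vary; uniqueness of the limit
   needs this generality. *)
have lim S w : is_G0 S -> (ncmul (ncexp (ncscale (- ln eps)%:C (ncB C))) (S (1 - eps)) w : C^o)
                @[eps --> (0 : R)^'+] --> (Phi w : C^o).
  move=> hS.
  have sH u : small (fun e => H true e%:C u - nc1 C u).
    exact: small_sub1 (H0 true) (Hh true).
  (* The error is Phi multiplied on the left by the conjugate of H_1(e) - 1 by e^B. An o(1) bound on
     H_1(e) - 1 would not survive the conjugation; smallness does. *)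
  have sD : small (fun e => ncmul (ncmul (expvar true (- ln e)%:C)
      (ncmul (fun u => H true e%:C u - nc1 C u) (expvar true (ln e)%:C))) Phi w).
    apply: small_mulr => u; apply: small_expvar_mull => v; exact: small_expvar_mulr.
  apply: small_cvg_to; apply: small_near sD; near=> e.
  have e01 : 0 < e < 1.
    apply/andP; split; near: e; first exact: nbhs_right_gt.
    by apply: nbhs_right_lt.
  have e01' : 0 < 1 - e < 1 by move: e01 => /andP[? ?]; rewrite subr_gt0 gtrBl; apply/andP.
  rewrite (is_G0_unique hS hG e01') /G G01 // subKr /local_sol.
  have -> : (fun u => H true e%:C u - nc1 C u) = ncadd (H true e%:C) (ncscale (-1) (nc1 C)).
    by apply/funext => u; rewrite /ncadd /ncscale mulN1r.
  rewrite ncmulDl ncmulZl ncmul1l ncmulDr ncmulZr rmorphN expvarKN ncmulDl ncmulZl ncmul1l.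
  by rewrite /ncadd /ncscale mulN1r -!ncmulA.
split; first by exists G => // w; exact: lim.
move=> Phi' [G' hG' PhiG']; apply/funext => w.
exact: (@field_cvg_unique C _ _ _ _ _ _ (lim G' w hG') (PhiG' w)).
Unshelve. all: by end_near.
Qed.

End Associator.

(** * Evaluation of series on nilpotent matrices *)

Section Evaluation.
Variables (L : numFieldType) (n : nat) (N : bool -> 'M[L]_n).
Implicit Types (S T : ncseries L) (u w : seq bool).

Definition wmx w : 'M[L]_n := foldr (fun a X => N a *m X) 1%:M w.

(** The words of length at most [k], listed by first letter so that evaluation recurses along
    [ncshift]. *)
Fixpoint words k : seq (seq bool) :=
  if k is k'.+1 then
    [::] :: map (cons false) (words k') ++ map (cons true) (words k')
  else [:: [::]].

Definition ncev k S : 'M[L]_n := \sum_(w <- words k) S w *: wmx w.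

Lemma ncev0 S : ncev 0 S = S [::] *: 1%:M.
Proof. by rewrite /ncev big_seq1. Qed.

Lemma ncevS k S : ncev k.+1 S = S [::] *: 1%:M +
  (N false *m ncev k (ncshift false S) + N true *m ncev k (ncshift true S)).
Proof.
rewrite /ncev big_cons big_cat !big_map !mulmx_sumr /=.
by congr (_ + (_ + _)); apply: eq_bigr => w _; rewrite -scalemxAr.
Qed.

Lemma ncevD k S T : ncev k (ncadd S T) = ncev k S + ncev k T.
Proof. by rewrite /ncev -big_split; apply: eq_bigr => w _; rewrite scalerDl. Qed.

Lemma ncevZ k c S : ncev k (ncscale c S) = c *: ncev k S.
Proof. by rewrite /ncev scaler_sumr; apply: eq_bigr => w _; rewrite scalerA. Qed.

Lemma ncev_1 k : ncev k (nc1 L) = 1%:M.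
Proof.
case: k => [|k]; first by rewrite ncev0 scale1r.
by rewrite ncevS /ncev !big1 ?mulmx0 ?addr0 ?scale1r // => w _; rewrite scale0r.
Qed.

Lemma ncev_var k a : ncev k.+1 (ncvar L a) = N a.
Proof.
rewrite ncevS !ncshift_var !ncevZ !ncev_1 scale0r add0r.
by case: a => /=; rewrite scale0r scale1r mulmx0 mulmx1 ?add0r ?addr0.
Qed.

Lemma ncev_pow a k S (s : nat -> L) :
  (forall w, S w = s (size w) * (all (pred1 a) w)%:R) ->
  ncev k S = \sum_(i < k.+1) s i *: N a ^+ i.
Proof.
elim: k S s => [|k IH] S s hS.
  by rewrite ncev0 big_ord_recl big_ord0 addr0 hS mulr1.
rewrite big_ord_recl ncevS hS mulr1; congr (_ + _).
have Sa : ncev k (ncshift a S) = \sum_(i < k.+1) s i.+1 *: N a ^+ i.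
  by apply: (IH _ (fun i => s i.+1)) => w; rewrite /ncshift hS /= eqxx.
have Sna : ncev k (ncshift (~~ a) S) = 0.
  rewrite /ncev big1 // => w _; rewrite /ncshift hS /=.
  by case: a {Sa IH hS} => /=; rewrite mulr0 scale0r.
have -> : N false *m ncev k (ncshift false S) + N true *m ncev k (ncshift true S)
  = N a *m ncev k (ncshift a S).
  by case: a Sna {Sa IH hS} => /= ->; rewrite mulmx0 ?addr0 ?add0r.
rewrite Sa mulmx_sumr; apply: eq_bigr => i _.
by rewrite -scalemxAr exprS.
Qed.

Hypothesis Nnil : forall w, (n <= size w)%N -> wmx w = 0.

Lemma wmx_cat u w : wmx (u ++ w) = wmx u *m wmx w.
Proof. by elim: u => [|a u IH] /=; rewrite ?mul1mx // IH mulmxA. Qed.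

Lemma wmx_rcons u a : wmx (rcons u a) = wmx u *m N a.
Proof. by rewrite -cats1 wmx_cat /= mulmx1. Qed.

(** Behind the prefix [u], only words of length less than n - |u| act nontrivially, and both depths
    cover them. The prefix is what makes induction possible: each letter taken from the series is
    moved into it. *)
Lemma wmx_ncev_stable u k l S : (n <= size u + k)%N -> (n <= size u + l)%N ->
  wmx u *m ncev k S = wmx u *m ncev l S.
Proof.
have small0 v i : (n <= size v + 0)%N -> wmx v *m ncev i S = 0.
  by rewrite addn0 => /Nnil->; rewrite mul0mx.
elim: k l u S {small0} => [|k IH] l u S.
  by rewrite addn0 => /Nnil-> _; rewrite !mul0mx.
case: l => [|l]; first by rewrite addn0 => _ /Nnil->; rewrite !mul0mx.
move=> uk ul; rewrite !ncevS !mulmxDr !mulmxA -!wmx_rcons.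
by congr (_ + (_ + _)); apply: IH; rewrite size_rcons addSnnS.
Qed.

(** Induction along the left quotients of [S]. The quotient of a product also contains a multiple of
    the quotient of [T]; these terms reassemble into the constant term of [S] times the evaluation
    of [T], whose depth may be changed by stability. *)
Lemma wmx_ncevM u k S T : (n <= size u + k)%N ->
  wmx u *m ncev k (ncmul S T) = wmx u *m (ncev k S *m ncev n T).
Proof.
elim: k u S => [|k IH] u S uk.
  by move: uk; rewrite addn0 => /Nnil->; rewrite !mul0mx.
have e : wmx u *m (S [::] *: ncev k.+1 T) = wmx u *m (S [::] *: ncev n T).
  rewrite -!scalemxAr (wmx_ncev_stable (l := n)) // leq_addl //.
rewrite ncevS [in RHS]ncevS ncmul_nil !mulmxDl !mulmxDr -scalemxAl mul1mx -e.
rewrite ncevS !ncshift_mul !ncevD !ncevZ !scalerDr !mulmxDr scalerA.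
rewrite -!addrA; congr (_ + _).
have h b : wmx u *m (N b *m ncev k (ncmul (ncshift b S) T)) =
    wmx u *m (N b *m ncev k (ncshift b S) *m ncev n T).
  by rewrite !mulmxA -wmx_rcons -mulmxA -IH ?size_rcons ?addSnnS.
by rewrite !h -!scalemxAr [RHS]addrA addrACA -!addrA.
Qed.

(** The depth is written [n.+1] to be visibly positive, as [ncev_var] requires of the evaluation of
    a letter. *)
Lemma ncevM S T : ncev n.+1 (ncmul S T) = ncev n.+1 S *m ncev n.+1 T.
Proof.
have h X : ncev n.+1 X = ncev n X.
  by rewrite -[LHS]mul1mx -[RHS]mul1mx; apply: (@wmx_ncev_stable [::]).
by rewrite !h -[LHS]mul1mx -[RHS]mul1mx; apply: (@wmx_ncevM [::]).
Qed.

Lemma exprmx_wmx a k : N a ^+ k = wmx (nseq k a).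
Proof. by elim: k => [//|k IH] /=; rewrite exprS IH. Qed.

Lemma exprmxZ c (X : 'M[L]_n) k : (c *: X) ^+ k = c ^+ k *: X ^+ k.
Proof.
elim: k => [|k IH]; first by rewrite !expr0 scale1r.
by rewrite !exprS IH -[LHS]/(_ *m _) -scalemxAl -scalemxAr scalerA.
Qed.

Lemma ncev_exp c a : ncev n.+1 (ncexp (ncscale c (ncvar L a))) = expmx (c *: N a).
Proof.
rewrite (@ncev_pow a _ _ (fun i => c ^+ i / i`!%:R)); last by move=> w; exact: ncexp_var.
have Nk k : (n <= k)%N -> (c *: N a) ^+ k = 0.
  by move=> nk; rewrite exprmxZ exprmx_wmx Nnil ?size_nseq // scaler0.
rewrite (@expmx_trunc _ _ _ n.+2) ?Nk // ?leqW // big_mkord.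
by apply: eq_bigr => i _; rewrite exprmxZ scalerA mulrC.
Qed.

End Evaluation.

(** * Flat sections and tangential values *)

Section MatrixSections.
Variables (R : realType) (n : nat) (N : bool -> 'M[R[i]]_n).
Local Notation C := (R[i]).
Hypothesis Nnil : forall w, (n <= size w)%N -> wmx N w = 0.
Implicit Types (m : nat) (a : bool) (t : R).

(** The matrices [N] stand for minus the residues, so this is minus the connection form and flat
    sections solve the KZ equation itself. *)
Definition connection_mx t : 'M[C]_n := t^-1%:C *: N false + (t - 1)^-1%:C *: N true.

Definition flat m (sigma : R -> 'M[C]_(n, m)) := forall t, 0 < t < 1 ->
  forall i j, cderive (fun u => sigma u i j) t ((connection_mx t *m sigma t) i j).

Definition tangential m a (sigma : R -> 'M[C]_(n, m)) (V : 'M[C]_(n, m)) :=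
  exists (r : R) (P : C -> 'M[C]_n),
    [/\ 0 < r, forall i j, holomorphic_on_disc r (fun z => P z i j), P 0 = 1%:M &
        forall t, 0 < t < 1 -> local_coordinate a t < r ->
          sigma t = P (local_coordinate a t)%:C
            *m expmx ((ln (local_coordinate a t))%:C *: N a) *m V].

Lemma local_coordinateK a : involutive (@local_coordinate R a).
Proof. by case: a => t //=; rewrite subKr. Qed.

Lemma local_coordinate01 a t : (0 < local_coordinate a t < 1) = (0 < t < 1).
Proof. by case: a => //=; rewrite subr_gt0 gtrBl andbC. Qed.

Definition smallmx p q (D : R -> 'M[C]_(p, q)) := forall i j, small (fun e => D e i j).

Lemma smallmxB p q (D D' : R -> 'M[C]_(p, q)) :
  smallmx D -> smallmx D' -> smallmx (fun e => D e - D' e).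
Proof.
move=> h h' i j; apply: small_ext (smallB (h i j) (h' i j)) => e.
by rewrite !mxE.
Qed.

Lemma smallmx_mull p q s (X : 'M[C]_(s, p)) (D : R -> 'M[C]_(p, q)) :
  smallmx D -> smallmx (fun e => X *m D e).
Proof.
move=> h i j.
apply: (@small_ext _ (fun e => \sum_k X i k * D e k j)) => [e|]; first by rewrite mxE.
by apply: small_sum => k _; apply: smallZ; exact: h.
Qed.

Lemma smallmx_mulr p q s (X : 'M[C]_(q, s)) (D : R -> 'M[C]_(p, q)) :
  smallmx D -> smallmx (fun e => D e *m X).
Proof.
move=> h i j.
apply: (@small_ext _ (fun e => \sum_k X k j * D e i k)) => [e|].
  by rewrite mxE; apply: eq_bigr => k _; rewrite mulrC.
by apply: small_sum => k _; apply: smallZ; exact: h.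
Qed.

Lemma smallmx_sum p q (I : Type) (s : seq I) (D : I -> R -> 'M[C]_(p, q)) :
  (forall i, smallmx (D i)) -> smallmx (fun e => \sum_(i <- s) D i e).
Proof.
move=> h i j; apply: (@small_ext _ (fun e => \sum_(k <- s) D k e i j)) => [e|].
  by rewrite summxE.
by apply: small_sum => k _; exact: h.
Qed.

(** By nilpotence the exponential is a finite sum over words, with entries polynomial in log e. *)
Lemma smallmx_mul_exp p a (D : R -> 'M[C]_(p, n)) :
  smallmx D -> smallmx (fun e => D e *m expmx ((ln e)%:C *: N a)).
Proof.
move=> hD i j.
apply: (@small_ext _ (fun e => (\sum_(w <- words n.+1)
    (ncexp (ncscale (ln e)%:C (ncvar C a)) w *: D e) *m wmx N w) i j)) => [e|].
  rewrite -ncev_exp // /ncev mulmx_sumr; congr (fun_of_matrix _ i j).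
  by apply: eq_bigr => w _; rewrite -scalemxAl -scalemxAr.
apply: smallmx_sum => w; apply: smallmx_mulr => k l.
apply: small_ext (smallZ ((size w)`!%:R^-1 * (all (pred1 a) w)%:R)
  (small_lnX (size w) (hD k l))) => e.
by rewrite mxE ncexp_var; ring.
Qed.

Lemma smallmx_exp_mul p a (D : R -> 'M[C]_(n, p)) :
  smallmx D -> smallmx (fun e => expmx ((- ln e)%:C *: N a) *m D e).
Proof.
move=> hD i j.
apply: (@small_ext _ (fun e => (\sum_(w <- words n.+1)
    wmx N w *m (ncexp (ncscale (- ln e)%:C (ncvar C a)) w *: D e)) i j)) => [e|].
  rewrite -ncev_exp // /ncev mulmx_suml; congr (fun_of_matrix _ i j).
  by apply: eq_bigr => w _; rewrite -scalemxAl -scalemxAr.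
apply: smallmx_sum => w; apply: smallmx_mull => k l.
apply: small_ext (smallZ ((size w)`!%:R^-1 * (all (pred1 a) w)%:R)
  (small_lnNX (size w) (hD k l))) => e.
by rewrite mxE ncexp_var; ring.
Qed.

Lemma expmx_NK c a : expmx ((- c) *: N a) *m expmx (c *: N a) = 1%:M.
Proof. by rewrite -!ncev_exp // -ncevM // expvarKN ncev_1. Qed.

(** Descending induction on the length of [u] shows that [wmx N u *m sigma] vanishes: its derivative
    is a combination of the same expression for the words [rcons u a], so it is constant, and the
    hypothesis applies. The empty word gives the claim. *)
Lemma flat_eq0 m (sigma : R -> 'M[C]_(n, m)) : flat sigma ->
  (forall (p : nat) (X : 'M[C]_(p, n)) (c : 'M[C]_(p, m)),
    (forall t, 0 < t < 1 -> X *m sigma t = c) -> c = 0) ->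
  forall t, 0 < t < 1 -> sigma t = 0.
Proof.
move=> fs s0 t t01; rewrite -[LHS]mul1mx.
suff h k u : (n <= size u + k)%N -> forall t, 0 < t < 1 -> wmx N u *m sigma t = 0.
  by have := h n [::]; rewrite /= leqnn; apply.
elim: k u {t t01} => [|k IH] u uk t t01.
  by rewrite Nnil ?mul0mx //; rewrite addn0 in uk.
apply: (s0 _ (wmx N u)) => x x01; apply/matrixP => i j.
have d0 y : 0 < y < 1 -> cderive (fun v => (wmx N u *m sigma v) i j) y 0.
  move=> y01; rewrite (_ : (fun v => _) = fun v => \sum_k wmx N u i k * sigma v k j).
    apply: cderive_eq (cderive_sum _ (fun k _ => cderiveZ (wmx N u i k) (fs y y01 k j))) _.
    transitivity ((wmx N u *m (connection_mx y *m sigma y)) i j); first by rewrite mxE.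
    rewrite /connection_mx mulmxDl -!scalemxAl mulmxDr -!scalemxAr !mulmxA -!wmx_rcons.
    by rewrite !IH ?size_rcons ?addSnnS // !scaler0 addr0 mxE.
  by apply/funext => v; rewrite mxE.
exact: cderive0_cst01 d0 _ _ x01 t01.
Qed.

Lemma tangential_near m a (sigma : R -> 'M[C]_(n, m)) V : tangential a sigma V ->
  exists P : R -> 'M[C]_n, smallmx (fun e => P e - 1%:M) /\
  \forall e \near 0^'+, sigma (local_coordinate a e) =
     P e *m expmx ((ln e)%:C *: N a) *m V.
Proof.
move=> [r [P [r0 Ph P0 sP]]]; exists (fun e => P e%:C); split.
  move=> i j; apply: small_ext (small_holomorphic r0 (Ph i j)) => e.
  by rewrite -P0 !mxE.
near=> e; rewrite -{2 3}[e](local_coordinateK a); apply: sP.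
  rewrite local_coordinate01; apply/andP; split; near: e; first exact: nbhs_right_gt.
  by apply: nbhs_right_lt.
by rewrite local_coordinateK; near: e; exact: nbhs_right_lt.
Unshelve. all: by end_near.
Qed.

Lemma smallmx_cst_eq0 p q (X : 'M[C]_(p, q)) (D : R -> 'M[C]_(p, q)) :
  smallmx D -> (\forall e \near 0^'+, D e = X) -> X = 0.
Proof.
move=> sD DX; apply/matrixP => i j; rewrite mxE; apply: small_cst_eq0.
apply: small_near (sD i j); near=> e.
by congr (fun_of_matrix _ i j); near: e.
Unshelve. all: by end_near.
Qed.

Lemma flat_tangential_unique m a (sigma tau : R -> 'M[C]_(n, m)) V :
  flat sigma -> flat tau -> tangential a sigma V -> tangential a tau V ->
  forall t, 0 < t < 1 -> sigma t = tau t.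
Proof.
move=> fs ft /tangential_near[P [sP sE]] /tangential_near[Q [sQ tE]] t t01.
apply/eqP; rewrite -subr_eq0; apply/eqP.
apply: (@flat_eq0 _ (fun t => sigma t - tau t)) t t01 => [t t01 i j|p X c hc].
  rewrite (_ : (fun u => _) = fun u => sigma u i j - tau u i j); last first.
    by apply/funext => u; rewrite !mxE.
  apply: cderive_eq (cderiveB (fs t t01 i j) (ft t t01 i j)) _.
  by rewrite mulmxBr [RHS]mxE [X in _ = _ + X]mxE.
have sPQ : smallmx (fun e => P e - Q e).
  move=> i j; apply: small_ext (smallmxB sP sQ i j) => e.
  by rewrite !mxE opprB addrA subrK.
apply: smallmx_cst_eq0 (smallmx_mull X (smallmx_mulr V (smallmx_mul_exp a sPQ))) _.
near=> e; rewrite -(hc (local_coordinate a e)).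
  rewrite (_ : sigma _ = P e *m expmx ((ln e)%:C *: N a) *m V); last by near: e.
  rewrite (_ : tau _ = Q e *m expmx ((ln e)%:C *: N a) *m V); last by near: e.
  by rewrite !mulmxBl.
rewrite local_coordinate01; apply/andP; split; near: e; first exact: nbhs_right_gt.
by apply: nbhs_right_lt.
Unshelve. all: by end_near.
Qed.

(** The value is recovered as the limit of e^(-N) sigma(e), since conjugation by e^N keeps P - 1
    small. *)
Lemma tangential_value_unique m a (sigma : R -> 'M[C]_(n, m)) V V' :
  tangential a sigma V -> tangential a sigma V' -> V = V'.
Proof.
move=> /tangential_near[P [sP sE]] /tangential_near[Q [sQ tE]].
have sV W (X : R -> 'M[C]_n) : smallmx (fun e => X e - 1%:M) -> smallmx (fun e =>
    expmx ((- ln e)%:C *: N a) *m (X e *m expmx ((ln e)%:C *: N a) *m W) - W :> 'M[C]_(n, m)).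
  move=> sX i j.
  apply: small_ext (smallmx_exp_mul a (smallmx_mulr W (smallmx_mul_exp a sX)) i j) => e.
  congr (fun_of_matrix _ i j); rewrite !mulmxBl mul1mx mulmxBr; congr (_ - _).
  by rewrite mulmxA rmorphN expmx_NK mul1mx.
apply/eqP; rewrite -subr_eq0; apply/eqP.
apply: smallmx_cst_eq0 (smallmxB (sV V' Q sQ) (sV V P sP)) _.
near=> e.
rewrite -[X in _ *m X - V'](_ : sigma (local_coordinate a e) = _); last by near: e.
rewrite -[X in _ - (_ *m X - V)](_ : sigma (local_coordinate a e) = _); last by near: e.
by rewrite opprB addrC addrA subrK.
Unshelve. all: by end_near.
Qed.

Lemma tangential_eq m a (sigma tau : R -> 'M[C]_(n, m)) V :
  (forall t, 0 < t < 1 -> sigma t = tau t) ->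
  tangential a sigma V -> tangential a tau V.
Proof.
move=> st [r [P [r0 Ph P0 sP]]]; exists r, P; split => // t t01 tr.
by rewrite -st // sP.
Qed.

Lemma tangential_mulr m m' a (sigma : R -> 'M[C]_(n, m)) V (X : 'M[C]_(m, m')) :
  tangential a sigma V -> tangential a (fun t => sigma t *m X) (V *m X).
Proof.
move=> [r [P [r0 Ph P0 sP]]]; exists r, P; split => // t t01 tr.
by rewrite sP // !mulmxA.
Qed.

Lemma flat_mulr m m' (sigma : R -> 'M[C]_(n, m)) (X : 'M[C]_(m, m')) :
  flat sigma -> flat (fun t => sigma t *m X).
Proof.
move=> fs t t01 i j.
rewrite (_ : (fun u => _) = fun u => \sum_k X k j * sigma u i k); last first.
  by apply/funext => u; rewrite mxE; apply: eq_bigr => k _; rewrite mulrC.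
apply: cderive_eq (cderive_sum _ (fun k _ => cderiveZ (X k j) (fs t t01 i k))) _.
by rewrite mulmxA [RHS]mxE; apply: eq_bigr => k _; rewrite mulrC.
Qed.

Lemma tangential0 m a : tangential a (fun=> 0 : 'M[C]_(n, m)) 0.
Proof.
exists 1, (fun=> 1%:M); split => // [i j|t _ _]; last by rewrite mulmx0.
exact: holomorphic_cst.
Qed.

Local Notation ev := (ncev N n.+1).

Lemma ev_KZ_form t : ev (KZ_form t) = connection_mx t.
Proof. by rewrite /KZ_form ncevD !ncevZ !ncev_var. Qed.

Lemma flat_ev (S : R -> ncseries C) : KZ_solution S -> flat (fun t => ev (S t)).
Proof.
move=> dS t t01 i j.
rewrite (_ : (fun u => _) = fun u => \sum_(w <- words n.+1) wmx N w i j * S u w); last first.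
  by apply/funext => u; rewrite summxE; apply: eq_bigr => w _; rewrite mxE mulrC.
apply: cderive_eq (cderive_sum _ (fun w _ => cderiveZ (wmx N w i j) (dS t t01 w))) _.
rewrite -ev_KZ_form -ncevM // summxE; apply: eq_bigr => w _.
by rewrite mxE mulrC.
Qed.

Lemma tangential_ev (H : C -> ncseries C) a : H 0 = nc1 C ->
  (forall w, holomorphic_on_disc 1 (fun z => H z w)) ->
  tangential a (fun t => ev (local_sol H a (local_coordinate a t))) 1%:M.
Proof.
move=> H0 Hh; exists 1, (fun z => ev (H z)); split => //.
- move=> i j.
  rewrite (_ : (fun z => _) = fun z => \sum_(w <- words n.+1) wmx N w i j * H z w).
    apply: holomorphic_sum => w _; apply: holomorphicM; last exact: Hh.
    exact: holomorphic_cst.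
  by apply/funext => z; rewrite summxE; apply: eq_bigr => w _; rewrite mxE mulrC.
- by rewrite H0 ncev_1.
- by move=> t _ _; rewrite /local_sol ncevM // ncev_exp // mulmx1.
Qed.

End MatrixSections.

(** * Tensor products of flat sections and of their tangential values *)

Section TensorProducts.
Variables (R : realType) (n1 n2 : nat).
Local Notation C := (R[i]).
Variables (A : bool -> 'M[C]_n1) (B : bool -> 'M[C]_n2).

Definition tens_action a : 'M[C]_(n1 * n2) := A a *t 1%:M + 1%:M *t B a.

Lemma connection_mx_tens t : connection_mx tens_action t =
  connection_mx A t *t 1%:M + 1%:M *t connection_mx B t.
Proof.
by apply/matrixP => i j; rewrite !mxE; ring.
Qed.

Lemma flat_tens m p (sigma : R -> 'M[C]_(n1, m)) (tau : R -> 'M[C]_(n2, p)) :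
  flat A sigma -> flat B tau -> flat tens_action (fun t => sigma t *t tau t).
Proof.
move=> fs ft t t01 i j; rewrite connection_mx_tens.
case: (mxtens_indexP i) => i0 i1; case: (mxtens_indexP j) => j0 j1.
rewrite (_ : (fun u => _) = fun u => sigma u i0 j0 * tau u i1 j1); last first.
  by apply/funext => u; rewrite tensmxE.
apply: cderive_eq (cderiveM (fs t t01 i0 j0) (ft t t01 i1 j1)) _.
by rewrite (mulmxDl (connection_mx A t *t _)) !tensmx_mul !mul1mx [RHS]mxE !tensmxE.
Qed.

(** The exponential of A (x) 1 + 1 (x) B splits because the two terms commute. Since [expmx] is a
    sum truncated at the matrix size, the splitting is stated under nilpotence. *)
Lemma tangential_tens m p a (sigma : R -> 'M[C]_(n1, m))
    (tau : R -> 'M[C]_(n2, p)) V W :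
  (forall c, (c *: A a) ^+ n1 = 0) -> (forall c, (c *: B a) ^+ n2 = 0) ->
  (forall c, (c *: tens_action a) ^+ (n1 * n2) = 0) ->
  tangential A a sigma V -> tangential B a tau W ->
  tangential tens_action a (fun t => sigma t *t tau t) (V *t W).
Proof.
move=> An Bn ABn [r [P [r0 Ph P0 sP]]] [s [Q [s0 Qh Q0 tQ]]].
exists (Num.min r s), (fun z => P z *t Q z); split.
- by rewrite lt_min r0.
- move=> i j; case: (mxtens_indexP i) => i0 i1; case: (mxtens_indexP j) => j0 j1.
  rewrite (_ : (fun z => _) = fun z => P z i0 j0 * Q z i1 j1); last first.
    by apply/funext => z; rewrite tensmxE.
  have rP : Num.min r s <= r by rewrite ge_min lexx.
  have rQ : Num.min r s <= s by rewrite ge_min lexx orbT.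
  exact: (holomorphicM (holomorphic_on_discW rP (Ph i0 j0))
                       (holomorphic_on_discW rQ (Qh i1 j1))).
- by rewrite P0 Q0 tens1mx1.
move=> t t01; rewrite lt_min => /andP[tr ts].
rewrite (sP t t01 tr) (tQ t t01 ts) -!tensmx_mul; congr (_ *m _ *m _).
set c := (ln _)%:C; rewrite /tens_action scalerDr -tensmxZl -tensmxZr.
rewrite expmx_tens ?An ?Bn //.
by rewrite tensmxZl tensmxZr -scalerDr ABn.
Qed.

End TensorProducts.

(** * The Betti path as a de Rham path over the complex numbers *)

Section BettiPathConstruction.
Variables (R : realType) (K : fieldType) (iota : {rmorphism K -> R[i]}).
Local Notation C := (R[i]).
Local Notation "A ^i" := (map_mx iota A) (at level 2, format "A ^i").
Implicit Types (M N : ncDR K) (a : bool).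

Definition res_action (M : conn K) a : 'M[C]_(rk M) := - (residue M (letter_cusp a))^i.

Lemma wmx_action (M : conn K) w : wmx (res_action M) w = (wordmx M w)^i.
Proof.
elim: w => [|a w IH] /=; first by rewrite map_mx1.
by rewrite IH map_mxM map_mxN.
Qed.

Lemma action_nil M w : (rk M <= size w)%N -> wmx (res_action M) w = 0.
Proof.
by move=> h; rewrite wmx_action unipotent_wordmx0 ?map_mx0 //; exact: ncDR_unipotent.
Qed.

Lemma connection_mx_res_action (M : conn K) t :
  connection_mx (res_action M) t = - connection_form iota M t.
Proof. by rewrite /connection_mx /connection_form !scalerN -opprD. Qed.

Lemma flat_sectionP (M : conn K) (sigma : R -> 'cV[C]_(rk M)) :
  flat_section iota sigma <-> flat (res_action M) sigma.
Proof.
split=> h t t01 i => [j|]; last first.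
  by have := h t t01 i 0; rewrite connection_mx_res_action mulNmx mxE.
rewrite (ord1 j); have := h t t01 i.
by rewrite connection_mx_res_action mulNmx [in X in _ -> X]mxE.
Qed.

Lemma tangential_valueP (M : conn K) a (sigma : R -> 'cV[C]_(rk M)) v :
  tangential_value iota a sigma v <-> tangential (res_action M) a sigma v.
Proof.
split=> -[r [P [r0 Ph P0 sP]]]; exists r, P; (split;
  [exact: r0|exact: Ph|exact: P0|move=> t t01 tr; rewrite (sP t t01 tr)]);
  by rewrite /res_action scalerN scaleNr.
Qed.

Lemma res_action_expr M c a k : (rk M <= k)%N -> (c *: res_action M a) ^+ k = 0.
Proof.
move=> hk; rewrite exprmxZ exprmx_wmx action_nil ?size_nseq //.
by rewrite scaler0.
Qed.

Lemma res_action_tens M N :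
  res_action (ncDR_tens M N) = tens_action (res_action M) (res_action N).
Proof.
apply/funext => a; rewrite /res_action /tens_action /= residue_tens map_mxD.
by rewrite !map_tensmx !map_mx1 opprD -tensmxNl -tensmxNr.
Qed.

Lemma flat_res_tens M N m p (sigma : R -> 'M[C]_(rk M, m)) (tau : R -> 'M[C]_(rk N, p)) :
  flat (res_action M) sigma -> flat (res_action N) tau ->
  flat (res_action (ncDR_tens M N)) (fun t => sigma t *t tau t).
Proof. by move=> fs ft; rewrite res_action_tens; exact: flat_tens. Qed.

Lemma tangential_res_tens M N m p a (sigma : R -> 'M[C]_(rk M, m))
    (tau : R -> 'M[C]_(rk N, p)) V W :
  tangential (res_action M) a sigma V -> tangential (res_action N) a tau W ->
  tangential (res_action (ncDR_tens M N)) a (fun t => sigma t *t tau t) (V *t W).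
Proof.
move=> hs ht; rewrite res_action_tens; apply: tangential_tens hs ht => c.
- exact: res_action_expr.
- exact: res_action_expr.
by rewrite -res_action_tens; exact: (@res_action_expr (ncDR_tens M N)).
Qed.

Section Construction.
Variables (H : bool -> C -> ncseries C) (Phi : ncseries C).
Hypotheses (H0 : forall a, H a 0 = nc1 C)
  (Hh : forall a w, holomorphic_on_disc 1 (fun z => H a z w))
  (KZ0 : KZ_solution (local_sol (H false) false))
  (KZ1 : KZ_solution (fun t => local_sol (H true) true (1 - t)))
  (G01 : forall t, 0 < t < 1 -> local_sol (H false) false t =
        ncmul (local_sol (H true) true (1 - t)) Phi)
  (Phi1 : Phi [::] = 1).

Local Notation ev M := (ncev (res_action M) (rk M).+1).

(** The fundamental matrix on [M] normalised at the cusp [a]: G_0 or G_1 evaluated on the object. *)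
Definition fund M a (t : R) : 'M[C]_(rk M) :=
  ev M (local_sol (H a) a (local_coordinate a t)).

Lemma flat_fund M a : flat (res_action M) (fund M a).
Proof. by case: a; apply: flat_ev => // w; exact: action_nil. Qed.

Lemma tangential_fund M a : tangential (res_action M) a (fund M a) 1%:M.
Proof. by apply: tangential_ev => // w; exact: action_nil. Qed.

Lemma fund_connection M t : 0 < t < 1 ->
  fund M false t = fund M true t *m ev M Phi.
Proof. move=> t01; rewrite /fund /= (G01 t01) ncevM //; exact: action_nil. Qed.

Lemma fund_tens M N a t : 0 < t < 1 ->
  fund (ncDR_tens M N) a t = fund M a t *t fund N a t.
Proof.
apply: (flat_tangential_unique (@action_nil (ncDR_tens M N))
  (@flat_fund _ a) (flat_res_tens (@flat_fund M a) (@flat_fund N a))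
  (tangential_fund _ a)).
by rewrite -tens1mx1; apply: tangential_res_tens; exact: tangential_fund.
Qed.

(** If Phi X = 0 on [M], then G_0 X = G_1 Phi X = 0, while X is the tangential value of G_0 X at 0;
    so X = 0. The transposes are there because [kermx] is a left kernel. *)
Lemma betti_unitmx M : ev M Phi \in unitmx.
Proof.
rewrite -unitmx_tr -row_free_unit -kermx_eq0; apply/eqP.
set X := kermx _; apply: trmx_inj; rewrite trmx0.
have bX : ev M Phi *m X^T = 0.
  by apply: trmx_inj; rewrite trmx_mul trmxK trmx0 mulmx_ker.
have h : tangential (res_action M) false (fun t => fund M false t *m X^T) (1%:M *m X^T).
  exact: tangential_mulr (tangential_fund M false).
rewrite -[LHS]mul1mx; apply: (tangential_value_unique (@action_nil M) h).
apply: tangential_eq (tangential0 _ _ _) => t t01.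
by rewrite fund_connection // -mulmxA bX mulmx0.
Qed.

Lemma ncev_level M k S : (rk M <= k)%N -> ncev (res_action M) k S = ev M S.
Proof.
move=> hk; rewrite -[LHS]mul1mx -[RHS]mul1mx.
by apply: (wmx_ncev_stable (@action_nil M) (u := [::])).
Qed.

Lemma betti_natural M N (f : 'M[K]_(rk N, rk M)) :
  horizontal f -> f^i *m ev M Phi = ev N Phi *m f^i.
Proof.
(* A common depth lets both evaluations run over the same list of words. *)
move=> hf; pose k := (rk M + rk N)%N.
rewrite -(@ncev_level M k) ?leq_addr // -(@ncev_level N k) ?leq_addl //.
rewrite /ncev mulmx_sumr mulmx_suml; apply: eq_bigr => w _.
by rewrite -scalemxAr -scalemxAl !wmx_action -!map_mxM horizontal_wordmx.
Qed.

(** This is the group-like property of Phi. Both sides are tangential values at 1 of one flat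
    section: G_0 of the tensor product, which is also the tensor product of the two G_0. *)
Lemma betti_tensor M N : ev (ncDR_tens M N) Phi = ev M Phi *t ev N Phi.
Proof.
have h1 := tangential_mulr (ev (ncDR_tens M N) Phi) (tangential_fund (ncDR_tens M N) true).
have h2 := tangential_mulr (ev M Phi *t ev N Phi) (tangential_fund (ncDR_tens M N) true).
rewrite mul1mx in h1; rewrite mul1mx in h2.
apply: (tangential_value_unique (@action_nil (ncDR_tens M N)) h1).
apply: tangential_eq h2 => t t01.
rewrite -(fund_connection (ncDR_tens M N) t01) !(fund_tens _ _ _ t01) tensmx_mul.
by rewrite -(fund_connection M t01) -(fund_connection N t01).
Qed.

Lemma betti_unit : ev (ncDR_unit K) Phi = 1%:M.
Proof.
rewrite ncevS Phi1 scale1r /res_action /=.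
by rewrite !map_mx0 oppr0 !mul0mx !addr0.
Qed.

Definition betti_path : dR_path iota (t01 K) (t10 K) :=
  DRPath (t01 K) (t10 K) betti_unitmx betti_natural betti_tensor betti_unit.

Lemma betti_pathP : is_betti_path betti_path.
Proof.
move=> M v; exists (fun t => fund M false t *m v); split.
- by apply/flat_sectionP; apply: flat_mulr; exact: flat_fund.
- apply/tangential_valueP; rewrite -[X in tangential _ _ _ X]mul1mx.
  exact: tangential_mulr (tangential_fund M false).
apply/tangential_valueP; rewrite -[X in tangential _ _ _ X]mul1mx.
apply: tangential_eq (tangential_mulr _ (tangential_fund M true)) => t t01.
by rewrite fund_connection // mulmxA.
Qed.

Lemma is_betti_path_unique b b' :
  @is_betti_path R K iota b -> @is_betti_path R K iota b' -> b = b'.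
Proof.
move=> hb hb'; apply: dR_path_eq => M; apply/matrixP => i j.
pose v : 'cV[C]_(rk M) := delta_mx j 0.
have [s [/flat_sectionP fs /tangential_valueP s0 /tangential_valueP s1]] := hb M v.
have [s' [/flat_sectionP fs' /tangential_valueP s0' /tangential_valueP s1']] := hb' M v.
have ss := flat_tangential_unique (@action_nil M) fs fs' s0 s0'.
have := tangential_value_unique (@action_nil M) (tangential_eq ss s1) s1'.
by rewrite -!colE => /matrixP/(_ i 0); rewrite !mxE.
Qed.

Lemma words_size k w : (w \in words k) = (size w <= k)%N.
Proof.
elim: k w => [|k IH] [|b w] //=; rewrite inE mem_cat //=.
have mc c : (b :: w \in map (cons c) (words k)) = (b == c) && (size w <= k)%N.
  apply/mapP/andP => [[u uk [-> ->]]|[/eqP-> wk]]; last by exists w; rewrite ?IH.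
  by rewrite eqxx -IH.
by rewrite !mc; case: b {mc}; rewrite /= ?orbF.
Qed.

Lemma words_uniq k : uniq (words k).
Proof.
elim: k => [//|k IH] /=.
rewrite mem_cat cat_uniq !map_inj_uniq ?IH ?andbT; try by move=> u v [].
apply/andP; split.
  by apply/negP => /orP[] /mapP[].
by apply/hasPn => w /mapP[u _ ->]; apply/mapP => -[].
Qed.

(** On the truncated word algebra a word u sends the empty word to u, so the matrix entry defining
    [iDR] selects the coefficient of [w] in Phi; the path d acts as the identity. *)
Lemma iDR_betti_path :
  iDR (path_comp (path_inv (path_d iota)) betti_path) = Phi.
Proof.
apply/funext => w; rewrite /iDR /= invmx1 mul1mx.
set M := word_object K (size w).
(* The summand [rk M] makes the depth admissible for nilpotence, and [size w] ensures that [w] is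
   among the words summed. *)
rewrite -(@ncev_level M (rk M + size w)) ?leq_addr // /ncev summxE.
have ww : w \in words (rk M + size w) by rewrite words_size leq_addl.
rewrite (bigD1_seq w) ?words_uniq // big1 => [|u uw].
  rewrite [LHS]addr0 mxE wmx_action mxE wordmx_word_conn !word_of_index // cats0.
  by rewrite eqxx rmorph1 mulr1.
rewrite mxE wmx_action mxE wordmx_word_conn !word_of_index // cats0.
by rewrite eq_sym (negbTE uw) rmorph0 mulr0.
Qed.

End Construction.
End BettiPathConstruction.

(* Both the comparison image b of the real path and the associator Phi_KZ exist
   and are unique. *)
Theorem proposition2p21 (R : realType) (K : fieldType)
    (iota : {rmorphism K -> R[i]}) :
  exists (b : dR_path iota (t01 K) (t10 K)) (PhiKZ : ncseries R[i]),
    [/\ unique (@is_betti_path R K iota) b,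
        unique (@is_PhiKZ R) PhiKZ &
        iDR (path_comp (path_inv (path_d iota)) b) = PhiKZ].
Proof.
have [H [Phi [H0 Hh [KZ0 KZ1] G01 Phi1]]] := @connection_series R.
exists (betti_path iota H0 Hh KZ0 KZ1 G01 Phi1), Phi; split.
- split; first exact: betti_pathP.
  by move=> b'; apply: is_betti_path_unique; exact: betti_pathP.
- exact: connection_series_PhiKZ G01.
- exact: iDR_betti_path.
Qed.
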